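(* Suppose Assumptions 1 and 2 hold. Consider TTTS-C (either the $m_c=1$ version or the top-$m_c$ version), where at step $t$ the Bernoulli parameter $\gamma(C_t)$ is replaced by a tuning hyperparameter $\gamma_t(C_t)\in(0,1)$ that is $\mathcal E_{t-1}$-measurable. Then for every $c\in\mathcal C$ and $d\in\mathcal D_c$, $\sum_{t=1}^T\mathbf 1\{D_t=d\}\to\infty$ almost surely as $T\to\infty$.
   Context: Setting. - $\mathcal C$ is a finite set of contexts and $\mathcal D=\bigsqcup_c\mathcal D_c$ a finite set of designs. - Densities $p(\cdot\mid\theta)$ are indexed by $\theta=(\mu,\eta)\in\Theta=M\times H$. - Design $d$ has true parameter $\theta^*_d$ with distinct $\mu^*_d$, and $\bm\theta^*$ is interior to $\bm\Theta=\Theta^{\mathcal D}$. - At step $t$ a pair $(C_t,D_t)$ is chosen and an independent sample $Y^{(t)}_{D_t}\sim p(\cdot\mid\theta^*_{D_t})$ is observed. - $\mathcal E_{t-1}$ is the $\sigma$-field of choices and observations up to step $t-1$. - $\Pi_t$ is the posterior on $\bm\Theta$ under a uniform prior. - Integers $1\le m_c\le|\mathcal D_c|$ are given. Assumption 1. $\Theta$ is compact with boundary of Lebesgue measure zero; $p(y\mid\theta)$ is continuous in $\theta$; identifiability; log-likelihood ratios form a universal Glivenko–Cantelli class. Assumption 2. The KL divergence $D(\theta^*\Vert\theta)$ is finite and continuously differentiable in $\theta$. TTTS-C, top-$m_c$ version (for $m_c=1$ it reduces to the best-design version). At step $t$: 1. Draw $\hat{\bm\theta}_1\sim\Pi_{t-1}$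 and let $\hat P_{c,1}$ be the $m_c$ designs in $\mathcal D_c$ with largest $\hat\mu_{1,d}$. 2. Redraw independent $\hat{\bm\theta}_2\sim\Pi_{t-1}$ (giving $\hat P_{c,2}$ likewise) until $\Delta_t=\{c:\hat P_{c,1}\ne\hat P_{c,2}\}\ne\emptyset$. 3. Pick $C_t$ uniformly in $\Delta_t$. 4. Pick $\tilde D$ uniformly in $\hat P_{C_t,1}\setminus\hat P_{C_t,2}$ and $\bar D$ uniformly in $\hat P_{C_t,2}\setminus\hat P_{C_t,1}$. 5. Set $D_t=\tilde D$ with probability $\gamma_t(C_t)$, else $D_t=\bar D$.
   Formalization: The theorem requires m_c < |D_c| for every context c; if m_c = |D_c|, the top set is always all of D_c, so c never lies in Δ_t and no design of D_c is ever sampled, making the claim as stated false. *)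

(* Defs.v *)
From HB Require Import structures.
From mathcomp Require Import all_boot all_order all_algebra.
From mathcomp Require Import all_classical all_reals all_analysis.

Set Implicit Arguments.
Unset Strict Implicit.
Unset Printing Implicit Defensive.

Import Order.TTheory GRing.Theory Num.Theory.
Import numFieldNormedType.Exports.

Local Open Scope classical_set_scope.
Local Open Scope ring_scope.

Definition Borel_rV (R : realType) (n : nat) := g_sigma_algebraType (@open 'rV[R]_n).

(** [lam] is Lebesgue measure on R^n: it gives every closed box its volume.
    (Boxes form a pi-system generating the Borel sets, so this determines
    Lebesgue measure uniquely.) *)
Definition is_lebesgue_rV (R : realType) (n : nat)
    (lam : {measure set (Borel_rV R n) -> \bar R}) : Prop :=
  forall a b : 'rV[R]_n, (forall i, a 0 i <= b 0 i) ->
    lam ([set x : 'rV[R]_n | forall i, a 0 i <= x 0 i <= b 0 i] : set (Borel_rV R n))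
      = (\prod_(i < n) (b 0 i - a 0 i))%:E.

(** theta = (mu, eta) with mu real and eta in R^k, coded as a row of size 1 + k. *)
Definition mu_of (R : realType) (k : nat) (th : 'rV[R]_k.+1) : R := th 0 0.
Definition eta_of (R : realType) (k : nat) (th : 'rV[R]_k.+1) : 'rV[R]_k :=
  @rsubmx R 1 1 k th.
Definition ParSpace (R : realType) (k : nat) (M : set R) (H : set 'rV[R]_k)
  : set 'rV[R]_k.+1 := [set th | M (mu_of th) /\ H (eta_of th)].

Definition C1_on (R : realType) (n : nat) (U : set 'rV[R]_n) (f : 'rV[R]_n -> R) : Prop :=
  (forall x, U x -> differentiable f x) /\
  (forall v : 'rV[R]_n, {within U, continuous (fun x => derive f x v)}).

(** Kullback-Leibler divergence D(P_th || P_th') between densities w.r.t. nu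
    (+oo when P_th is not absolutely continuous w.r.t. P_th'). *)
Definition KL (R : realType) (k : nat) (dY : measure_display) (Y : measurableType dY)
    (nu : {measure set Y -> \bar R}) (p : 'rV[R]_k.+1 -> Y -> R)
    (th th' : 'rV[R]_k.+1) : \bar R :=
  if pselect (nu [set y | 0 < p th y /\ p th' y = 0] = 0%E)
  then (\int[nu]_y (p th y * ln (p th y / p th' y))%:E)%E
  else +oo%E.

Definition LLR (R : realType) (k : nat) (Y : Type) (Th : set 'rV[R]_k.+1)
    (p : 'rV[R]_k.+1 -> Y -> R) : set (Y -> R) :=
  [set f | exists th th', Th th /\ Th th' /\ f = (fun y => ln (p th y / p th' y))].

Definition iid_with_law (R : realType) (dO : measure_display) (O : measurableType dO)
    (P : probability O R) (dY : measure_display) (Y : measurableType dY)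
    (Q : probability Y R) (X : nat -> O -> Y) : Prop :=
  (forall i, measurable_fun setT (X i)) /\
  (forall i (B : set Y), measurable B -> P (X i @^-1` B) = Q B) /\
  (forall (n : nat) (B : nat -> set Y), (forall i, measurable (B i)) ->
     P (\bigcap_(i in `I_n) X i @^-1` B i) = (\prod_(i < n) P (X i @^-1` B i))%E).

Definition universal_GC (R : realType) (dY : measure_display) (Y : measurableType dY)
    (F : set (Y -> R)) : Prop :=
  forall Q : probability Y R,
    (forall f, F f -> Q.-integrable setT (EFin \o f)) /\
    (forall (dO : measure_display) (O : measurableType dO) (P : probability O R)
            (X : nat -> O -> Y),
       iid_with_law P Q X ->
       {ae P, forall w,
          (fun n : nat => ereal_sup
             [set (`| n.+1%:R^-1 * (\sum_(i < n.+1) f (X i w))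
                     - fine (\int[Q]_y (f y)%:E)%E |)%:E | f in F]) @ \oo --> 0%E}).

(** The top-m_c designs of context c for a vector of means mu: designs of
    context c beaten by fewer than m_c designs of the same context
    (exactly the m_c largest when there are no ties). *)
Definition topset (R : realType) (Ctx Des : finType) (ctx : Des -> Ctx)
    (m : Ctx -> nat) (mu : Des -> R) (c : Ctx) : {set Des} :=
  [set d | (ctx d == c) &&
           (#|[set d' | (ctx d' == c) && (mu d < mu d')%R]| < m c)%N].

Definition Delta (R : realType) (Ctx Des : finType) (ctx : Des -> Ctx)
    (m : Ctx -> nat) (mu1 mu2 : Des -> R) : {set Ctx} :=
  [set c | topset ctx m mu1 c != topset ctx m mu2 c].

Definition first_index (P : pred nat) : option nat :=
  match pselect (exists j, P j) with
  | left h => Some (ex_minn h)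
  | right _ => None
  end.

(** Given the draws th 0 (= theta_hat_1) and th 1, th 2, ... (successive
    independent candidates for theta_hat_2, the first one giving a nonempty
    Delta being accepted) and gamma, the probability that TTTS-C
    (steps 3-5) chooses context c and design d. *)
Definition sel_prob (R : realType) (k : nat) (Ctx Des : finType) (ctx : Des -> Ctx)
    (m : Ctx -> nat) (th : nat -> Des -> 'rV[R]_k.+1) (g : Ctx -> R)
    (c : Ctx) (d : Des) : R :=
  let mu1 := fun e => mu_of (th 0%N e) in
  match first_index (fun j => (0 < j)%N &&
           (0 < #|Delta ctx m mu1 (fun e => mu_of (th j e))|)%N) with
  | None => 0
  | Some j =>
      let mu2 := fun e => mu_of (th j e) in
      let Dl := Delta ctx m mu1 mu2 in
      let P1 := topset ctx m mu1 c in
      let P2 := topset ctx m mu2 c in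
      (c \in Dl)%:R / #|Dl|%:R *
        (g c * ((d \in P1 :\: P2)%:R / #|P1 :\: P2|%:R)
         + (1 - g c) * ((d \in P2 :\: P1)%:R / #|P2 :\: P1|%:R))
  end.

Definition lik (R : realType) (k : nat) (Des : finType) (Y : Type)
    (p : 'rV[R]_k.+1 -> Y -> R) (Ds : nat -> Des) (Ys : nat -> Y)
    (t : nat) (d : Des) (th : 'rV[R]_k.+1) : R :=
  \prod_(s < t | Ds s == d) p th (Ys s).

(** posterior probability (uniform prior on Theta) of {theta_d in B} given the
    observations before step t; the posterior on Theta^D is the product of these
    marginals over the designs. *)
Definition post (R : realType) (k : nat) (Des : finType) (Y : Type)
    (lam : {measure set (Borel_rV R k.+1) -> \bar R}) (Th : set 'rV[R]_k.+1)
    (p : 'rV[R]_k.+1 -> Y -> R) (Ds : nat -> Des) (Ys : nat -> Y)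
    (t : nat) (d : Des) (B : set 'rV[R]_k.+1) : R :=
  fine (\int[lam]_(x in (B `&` Th : set (Borel_rV R k.+1))) (lik p Ds Ys t d x)%:E)%E
  / fine (\int[lam]_(x in (Th : set (Borel_rV R k.+1))) (lik p Ds Ys t d x)%:E)%E.

Definition obs_gen (Om Ctx Des : Type) (dY : measure_display) (Y : measurableType dY)
    (C : nat -> Om -> Ctx) (D : nat -> Om -> Des) (Ys : nat -> Om -> Y) (t : nat)
    : set (set Om) :=
  [set A | exists2 s, (s < t)%N &
     ((exists c, A = C s @^-1` [set c]) \/ (exists d, A = D s @^-1` [set d]) \/
      (exists B : set Y, measurable B /\ A = Ys s @^-1` B))].

Definition draw_gen (R : realType) (k : nat) (Om Des : Type)
    (Th : nat -> nat -> Om -> Des -> 'rV[R]_k.+1) (t : nat) : set (set Om) :=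
  [set A | exists s j d (B : set (Borel_rV R k.+1)),
     [/\ (s < t)%N, measurable B & A = (fun w => Th s j w d) @^-1` B]].

Definition cd_gen (Om Ctx Des : Type) (C : nat -> Om -> Ctx) (D : nat -> Om -> Des)
    (t : nat) : set (set Om) :=
  [set A | (exists c, A = C t @^-1` [set c]) \/ (exists d, A = D t @^-1` [set d])].

(* Main.v *)
Require Import Defs.
From HB Require Import structures.
From mathcomp Require Import all_boot all_order all_algebra.
From mathcomp Require Import all_classical all_reals all_analysis.
From mathcomp Require Import measurable_realfun ring lra.

(** For a design e, consider a set B of parameters giving some event noticeably
    more mass than the true density does, and a set U of parameters with small
    Kullback-Leibler divergence from the truth and bounded log-likelihood ratios.
    Whatever the sampling rule, a small power of the posterior odds of B against U
    is a nonnegative supermartingale, hence almost surely bounded over time.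
    By compactness of the parameter space, the posterior mass of every open
    neighbourhood of theta*_e therefore stays bounded away from 0, whether e is
    sampled finitely or infinitely often.
    If d were sampled finitely often, its posterior would be eventually constant,
    with full support. Two independent draws would then rank d first and last among
    the designs, in either order, with probability bounded below; since gamma_t or
    1 - gamma_t is at least 1/2, one of the two orders makes the first redraw
    select d with conditional probability bounded below, and a conditional
    Borel-Cantelli argument gives a contradiction. *)

Set Implicit Arguments.
Unset Strict Implicit.
Unset Printing Implicit Defensive.

Import Order.TTheory GRing.Theory Num.Theory.
Import numFieldNormedType.Exports.

Local Open Scope classical_set_scope.
Local Open Scope ring_scope.

(** * Elementary inequalities *)

(** The obstacle is adaptive sampling: how often a design is observed is random and depends on the
    data, so the proof relies on an inequality for a single update, valid after every history. The
    posterior odds themselves may grow in mean under the truth, because the parameters in U only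
    approximate it. For a small power [l], the mean changes to first order by [l] times a drift. The
    drift costs at most the divergence of U, bounded by [e ^+ 2 / 8], and gains [e ^+ 2 / 4] from an
    event on which every parameter of B exceeds the true mass by [e]. Such an excess survives
    averaging over B, so it holds for the predictive density whatever the weights left by the past;
    this is why B is described by a test event. Bounded log-likelihood ratios control the
    second-order terms. They come from integrability under every law, with a bound depending on the
    parameter, so U has to be cut down to a set of positive prior mass on which a single bound
    holds. *)

Section real_ineq.
Context {R : realType}.
Implicit Types x l t : R.

(** Concavity of [ln] at [1 - l + l * x], the average of [x] and 1 with weights [l] and [1 - l]. *)
Lemma powR_le_tangent x l : 0 <= x -> 0 < l -> l <= 1 ->
  x `^ l <= 1 - l + l * x.
Proof.
rewrite le_eqVlt => /predU1P[<- l0 l1|x0 l0 l1].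
  by rewrite powR0 ?gt_eqF// mulr0 addr0 subr_ge0.
have s0 : 0 < 1 - l + l * x by nra.
have H (a b : R) : 0 < a -> 0 < b -> ln a - ln b <= a / b - 1.
  move=> a0 b0; rewrite -ln_div ?posrE//.
  have := expR_ge1Dx (ln (a / b)); rewrite lnK ?posrE ?divr_gt0//; lra.
have H1 := H _ _ x0 s0; have H2 := H _ _ (@ltr01 R) s0.
rewrite ln1 in H2.
rewrite -ler_ln ?posrE ?powR_gt0// ln_powR.
have : l * (x / (1 - l + l * x)) + (1 - l) * (1 / (1 - l + l * x)) = 1.
  by field; rewrite gt_eqF.
nra.
Qed.

(** Tangent at [t = 1] of the convex function [t ^ (-l)]; averaged over a mixture it yields Jensen's
    inequality. *)
Lemma powRN_ge_tangent t l : 0 < t -> 0 < l -> 1 + l - l * t <= (t^-1) `^ l.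
Proof.
move=> t0 l0; rewrite /powR gt_eqF ?invr_gt0//.
apply: le_trans (expR_ge1Dx _); rewrite lnV ?posrE//.
have : ln t <= t - 1 by have := expR_ge1Dx (ln t); rewrite lnK ?posrE//; lra.
nra.
Qed.

(** [expR x] is at most [1 / (1 - x)], and [(1 + x + 2 x^2) (1 - x) = 1 + x^2 (1 - 2 x)] is at least
    1 because [x <= 1/2]. *)
Lemma expR_le_quad x : x <= 1/2 -> expR x <= 1 + x + 2 * x ^+ 2.
Proof.
move=> x2; have x1 : 0 < 1 - x by lra.
have := expR_ge1Dx (- x); rewrite expRN => h.
have : expR x * (1 - x) <= 1.
  by rewrite -ler_pdivlMl ?expR_gt0// mulr1.
have e0 := expR_gt0 x; move=> h2.
have : (1 + x + 2 * x ^+ 2) * (1 - x) >= 1.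
  have : 0 <= x ^+ 2 by exact: sqr_ge0.
  nra.
by move=> h3; rewrite -(ler_pM2r x1); apply: le_trans h2 h3.
Qed.

Lemma expR_le_lin x : 0 <= x -> x <= 1/2 -> expR x <= 1 + 2 * x.
Proof. by move=> x0 x2; apply: le_trans (expR_le_quad x2) _; nra. Qed.

End real_ineq.

Section measurable_div.
Context d (T : measurableType d) (R : realType).
Implicit Types f g : T -> R.

(** The inverse is read as the power [-1], which agrees with it on nonnegative numbers, 0
    included. *)
Lemma measurable_fun_div f g : (forall x, 0 <= g x) ->
  measurable_fun setT f -> measurable_fun setT g ->
  measurable_fun setT (fun x => f x / g x).
Proof.
move=> g0 mf mg; apply: measurable_funM => //.
rewrite (_ : (fun x => _) = (powR (R:=R))^~ (-1) \o g).
  exact: measurableT_comp (measurable_powR _) mg.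
by apply/funext => x /=; rewrite powR_inv1.
Qed.

Lemma measurable_fun_powR f l : measurable_fun setT f ->
  measurable_fun setT (fun x => f x `^ l).
Proof. by move=> mf; exact: measurableT_comp (measurable_powR _) mf. Qed.

Lemma measurable_pred (b : T -> bool) :
  measurable_fun setT b -> measurable [set x | b x].
Proof.
by move=> mb; rewrite -[X in measurable X]setTI; exact: (mb measurableT [set true]).
Qed.

Lemma measurable_mem (A : set T) : measurable A ->
  measurable_fun setT (fun x => x \in A).
Proof.
move=> mA; apply: (measurable_fun_bool true); rewrite setTI.
by rewrite (_ : _ @^-1` _ = A)//; apply/seteqP; split => y /=; [exact: set_mem|exact: mem_set].
Qed.

End measurable_div.

Section odds_ineq.
Context {R : realType}.
Implicit Types l n e pA N qa qb ps tau : R.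

(* [e] is the separation of the test event and [N - 1] bounds the log-likelihood
   ratios: with this [l] the first-order gain [l * e ^+ 2 / 8] beats all the
   terms of order [l ^+ 2]. *)
Lemma odds_step_arith l e N n pA : 0 < e -> 1 <= N -> 0 <= n -> n <= N ->
  0 <= pA -> pA + e <= 1 -> l = e ^+ 2 / (48 * N ^+ 2) ->
  (1 - l) * (1 + l * (e ^+ 2 / 8) + 2 * l ^+ 2 * n ^+ 2
     + l * (e / 2) * (1 + 2 * (l * N)) * pA)
  + l * (1 + 2 * (l * N)) * (1 - e / 2 * (pA + e / 2)) <= 1.
Proof.
move=> e0 N1 n0 nN pA0 pA1 lE.
have N0 : 0 < N by lra.
have lN : l * N ^+ 2 = e ^+ 2 / 48 by rewrite lE; field; rewrite gt_eqF.
have l0 : 0 < l by rewrite lE divr_gt0 ?mulr_gt0 ?exprn_gt0.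
set X := l * (e ^+ 2 / 8) + 2 * l ^+ 2 * n ^+ 2 + l * (e / 2) * (1 + 2 * (l * N)) * pA.
have lN0 : 0 < l * N by rewrite mulr_gt0.
have X0 : 0 <= X.
  rewrite /X; apply: addr_ge0; first apply: addr_ge0.
  - by rewrite mulr_ge0 ?divr_ge0 ?sqr_ge0// ltW.
  - by rewrite -mulrA mulr_ge0// mulr_ge0 ?sqr_ge0.
  - by rewrite mulr_ge0// mulr_ge0 ?mulr_ge0 ?divr_ge0//; lra.
set z := e / 2 * (pA + e / 2).
have z0 : 0 <= z by rewrite /z !mulr_ge0 ?addr_ge0 ?divr_ge0// ltW.
have -> : 1 + l * (e ^+ 2 / 8) + 2 * l ^+ 2 * n ^+ 2 + l * (e / 2) * (1 + 2 * (l * N)) * pA = 1 + X.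
  by rewrite /X; ring.
have h1 : (1 - l) * (1 + X) <= 1 - l + X by nra.
have l2N : 0 <= l ^+ 2 * N by rewrite mulr_ge0 ?sqr_ge0// ltW.
have h2 : l * (1 + 2 * (l * N)) * (1 - z) <= l - l * z + 2 * (l ^+ 2 * N).
  have : 0 <= (l ^+ 2 * N) * z by rewrite mulr_ge0.
  have -> : l * (1 + 2 * (l * N)) * (1 - z) = l - l * z + 2 * (l ^+ 2 * N) - 2 * (l ^+ 2 * N * z) by ring.
  lra.
have h3 : l ^+ 2 * n ^+ 2 <= l ^+ 2 * N ^+ 2.
  by rewrite ler_wpM2l ?sqr_ge0// ler_sqr ?nnegrE// ltW.
have h4 : l ^+ 2 * N <= l ^+ 2 * N ^+ 2.
  by rewrite ler_wpM2l ?sqr_ge0//; nra.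
have h5 : l ^+ 2 * N * (e * pA) <= l ^+ 2 * N.
  by rewrite ler_piMr//; nra.
(* Origin of 48: the second-order terms total at most [5 l^2 N^2 = 5 l e^2 / 48], below the net gain
   [l e^2 / 8 = 6 l e^2 / 48]. *)
have h6 : l ^+ 2 * N ^+ 2 = l * (e ^+ 2) / 48 by rewrite expr2 -mulrA lN; ring.
have h7 : 0 <= l * e ^+ 2 by rewrite mulr_ge0 ?sqr_ge0// ltW.
have XE : X = l * e ^+ 2 / 8 + 2 * (l ^+ 2 * n ^+ 2) + l * (e / 2) * pA + l ^+ 2 * N * (e * pA).
  by rewrite /X; field.
have zE : l * z = l * (e / 2) * pA + l * e ^+ 2 / 4 by rewrite /z; field.
lra.
Qed.

(** [K] bounds the [l]-th power of [ps / qb], with or without the factor [1 + tau]: this product is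
    at most [(1 + tau) * expR n <= expR (n + 1)], whence the shift to [n + 1]. Integrated in [y],
    the three summands give a moment governed by the divergence, the true mass of the test event,
    and the reweighted mass of the mixture [qa]. *)
Lemma odds_pointwise ps qa qb tau n l (inA : bool) :
  0 < ps -> 0 <= qa -> expR (- n) * ps <= qb -> 0 <= tau -> tau <= 1 ->
  0 <= n -> 0 < l -> l <= 1 -> l * (n + 1) <= 1/2 ->
  forall K, K = 1 + 2 * (l * (n + 1)) ->
  ps * (qa / qb) `^ l <= (1 - l) * (ps * (ps / qb) `^ l)
    + (1 - l) * (l * tau * K) * (if inA then ps else 0)
    + l * K * (qa / (if inA then 1 + tau else 1)).
Proof.
move=> p0 qa0 low t0 t1 n0 l0 l1 lnh K KE.
have qb0 : 0 < qb by apply: lt_le_trans low; rewrite mulr_gt0 ?expR_gt0.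
set w := if inA then 1 + tau else 1.
have w1 : 1 <= w /\ w <= 1 + tau by rewrite /w; case: (inA); split; lra.
have w0 : 0 < w by lra.
pose b := ps / qb.
have b0 : 0 < b by rewrite divr_gt0.
have bn : b <= expR n.
  by rewrite ler_pdivrMr// -ler_pdivrMl ?expR_gt0// -expRN.
have K0 : 0 <= K by rewrite KE addr_ge0 ?mulr_ge0// ?addr_ge0// ltW.
have powK c : 0 < c -> c <= (1 + tau) * expR n -> c `^ l <= K.
  move=> c0 cn; rewrite KE; apply: le_trans (expR_le_lin _ lnh); last by rewrite mulr_ge0 ?addr_ge0// ltW.
  rewrite /powR gt_eqF// ler_expR ler_pM2l//.
  have : ln c <= ln ((1 + tau) * expR n) by rewrite ler_ln ?posrE ?mulr_gt0 ?expR_gt0//; lra.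
  rewrite lnM ?posrE ?expR_gt0//; last by lra.
  rewrite expRK; have := expR_ge1Dx (ln (1 + tau)); rewrite lnK ?posrE; last by lra.
  lra.
have bK : b `^ l <= K.
  by apply: powK => //; apply: le_trans bn _; rewrite ler_peMl ?expR_ge0//; lra.
have wbK : (w * b) `^ l <= K.
  apply: powK; first by rewrite mulr_gt0.
  by apply: ler_pM; rewrite ?(ltW w0) ?(ltW b0)//; case: w1.
have wl : w `^ l <= 1 + l * (w - 1) by have := powR_le_tangent (ltW w0) l0 l1; lra.
pose x := qa / (w * ps).
have x0 : 0 <= x by rewrite divr_ge0// mulr_ge0// ltW.
have -> : qa / qb = x * (w * b) by rewrite /x /b; field; rewrite !gt_eqF.
rewrite powRM//; last by rewrite mulr_ge0 ?ltW.
have xl := powR_le_tangent x0 l0 l1.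
have wb0 : 0 <= (w * b) `^ l by exact: powR_ge0.
have wbE : (w * b) `^ l <= b `^ l + l * (w - 1) * K.
  rewrite powRM ?(ltW w0) ?(ltW b0)//.
  have := powR_ge0 b l; set u := b `^ l in bK * => u0.
  have : w `^ l * u <= (1 + l * (w - 1)) * u by rewrite ler_wpM2r.
  have : l * (w - 1) * u <= l * (w - 1) * K.
    by rewrite ler_wpM2l// mulr_ge0 ?(ltW l0)// subr_ge0; case: w1.
  lra.
have l1' : 0 <= 1 - l by lra.
have H : x `^ l * (w * b) `^ l <= (1 - l) * (b `^ l + l * (w - 1) * K) + l * x * K.
  apply: (@le_trans _ _ ((1 - l + l * x) * (w * b) `^ l)); first by rewrite ler_wpM2r.
  rewrite mulrDl lerD//; first by rewrite ler_wpM2l.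
  by rewrite ler_wpM2l// mulr_ge0// ltW.
apply: (@le_trans _ _ (ps * ((1 - l) * (b `^ l + l * (w - 1) * K) + l * x * K))).
  by rewrite ler_wpM2l// ltW.
rewrite le_eqVlt; apply/orP; left; apply/eqP.
have -> : qa / w = ps * x by rewrite /x; field; rewrite !gt_eqF.
by rewrite -/b /w; case: (inA); ring.
Qed.

End odds_ineq.

(** * Measures with a density *)

Section mdensity.
Context d (T : measurableType d) (R : realType).
Variables (mu : {measure set T -> \bar R}) (g : T -> R).

(** The two proofs are arguments so that the measure structure can be attached to this name. *)
Definition mdensity of measurable_fun setT g & (forall x, 0 <= g x) :=
  fun B : set T => (\int[mu]_(x in B) (g x)%:E)%E.

Hypotheses (mg : measurable_fun setT g) (g0 : forall x, 0 <= g x).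
Local Notation m := (mdensity mg g0).

Let m0 : m set0 = 0%E. Proof. by rewrite /mdensity integral_set0. Qed.

Let m_ge0 B : (0 <= m B)%E.
Proof. by apply: integral_ge0 => x _; rewrite lee_fin. Qed.

Let m_sigma_additive : semi_sigma_additive m.
Proof.
move=> F mF tF mUF; rewrite /mdensity ge0_integral_bigcup//.
- by apply: is_cvg_ereal_nneg_natsum_cond => n _ _; exact: m_ge0.
- exact/measurable_EFinP/measurable_funTS.
- by move=> x _; rewrite lee_fin.
Qed.

HB.instance Definition _ := isMeasure.Build _ _ _ m m0 m_ge0 m_sigma_additive.

Import HBNNSimple.

(** Monotone convergence reduces both sides to the same simple functions, for which the identity is
    the definition of [mdensity] on level sets. *)
Lemma ge0_integral_mdensity (f : T -> \bar R) :
  measurable_fun setT f -> (forall x, 0 <= f x)%E ->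
  (\int[m]_x f x = \int[mu]_x (f x * (g x)%:E))%E.
Proof.
move=> mf f0; pose h := nnsfun_approx measurableT mf.
have mgE : measurable_fun setT (EFin \o g) by exact/measurable_EFinP.
have cf x : (EFin \o h ^~ x) n @[n --> \oo] --> f x.
  exact: cvg_nnsfun_approx.
have hh n x : measurable_fun setT (EFin \o h n).
  exact/measurable_EFinP/measurable_funP.
transitivity (\int[m]_x limn (fun n => (h n x)%:E))%E.
  by apply: eq_integral => x _; apply/esym/cvg_lim => //; exact: cf.
rewrite monotone_convergence//; last 3 first.
- by move=> n; exact: hh.
- by move=> n x _; rewrite lee_fin.
- by move=> x _ a b ab; rewrite lee_fin; exact/lefP/nd_nnsfun_approx.
transitivity (\int[mu]_x limn (fun n => (h n x)%:E * (g x)%:E))%E; last first.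
  apply: eq_integral => x _; apply/cvg_lim => //.
  by apply: cvgeZr; [|exact: cf].
rewrite monotone_convergence//; last 3 first.
- by move=> n; apply: emeasurable_funM => //; exact: hh.
- by move=> n x _; rewrite -EFinM lee_fin mulr_ge0.
- move=> x _ a b ab; rewrite -!EFinM lee_fin ler_wpM2r//.
  exact/lefP/nd_nnsfun_approx.
congr (limn _); apply/funext => n.
have mh y : measurable (h n @^-1` [set y]) by [].
transitivity (\sum_(y \in range (h n)) y%:E * m (h n @^-1` [set y]))%E.
  by rewrite integralT_nnsfun sintegralE.
under [RHS]eq_integral => x _.
  rewrite (fimfunE (h n) x) -fsumEFin// ge0_mule_fsuml; last first.
    by move=> y; exact: nnfun_muleindic_ge0.
  over.
rewrite ge0_integral_fsum//; last 2 first.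
- move=> y; apply: emeasurable_funM => //; apply/measurable_EFinP.
  exact: measurable_funM.
- by move=> y x _; rewrite mule_ge0 ?EFinM ?nnfun_muleindic_ge0 ?lee_fin.
apply: eq_fsbigr => y; rewrite inE => -[x _ <-].
under eq_integral do rewrite EFinM -muleA.
rewrite ge0_integralZl_EFin//; last 2 first.
- by move=> z _; rewrite -EFinM lee_fin mulr_ge0.
- by apply: emeasurable_funM => //; exact/measurable_EFinP.
congr (_ * _)%E; rewrite /mdensity integral_mkcond.
apply: eq_integral => z _; rewrite epatch_indic/=.
by rewrite muleC.
Qed.

End mdensity.

Section sigma_finite_measure_of.
Context d (T : measurableType d) (R : realType) (mu : {measure set T -> \bar R}).

(* [mu] itself, under a name to which the sigma-finite structure can be attached. *)
Definition sigma_finite_copy of sigma_finite setT mu : set T -> \bar R := mu.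

Hypothesis mu_sf : sigma_finite setT mu.
Local Notation m := (sigma_finite_copy mu_sf).

HB.instance Definition _ := isMeasure.Build _ _ _ m
  (measure0 mu) (measure_ge0 mu) (@measure_semi_sigma_additive _ _ _ mu).

HB.instance Definition _ := Measure_isSigmaFinite.Build _ _ _ m mu_sf.

Definition sigma_finite_measure_of : {sigma_finite_measure set T -> \bar R} := m.

End sigma_finite_measure_of.

(** * One Bayesian update of the posterior odds *)

Section tilted.
Context d (Y : measurableType d) (R : realType) (nu : {measure set Y -> \bar R}).

(** Second-order expansion of [expR (l * X)] with [X = ln (ps / f)]: the linear term is the
    Kullback-Leibler integral, and [|X| <= n] almost everywhere under [ps] controls the square. *)
Lemma tilted_moment (ps f : Y -> R) (n e l : R) :
  measurable_fun setT ps -> measurable_fun setT f ->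
  (forall y, 0 <= ps y) -> (forall y, 0 <= f y) -> (\int[nu]_y (ps y)%:E = 1)%E ->
  0 <= n -> 0 < l -> l * n <= 1/2 ->
  nu [set y | (0 < ps y) && ~~ (expR (- n) * ps y <= f y <= expR n * ps y)] = 0 ->
  (\int[nu]_y (ps y * ln (ps y / f y))%:E <= e%:E)%E ->
  (\int[nu]_y (ps y * (ps y / f y) `^ l)%:E <= (1 + l * e + 2 * l ^+ 2 * n ^+ 2)%:E)%E.
Proof.
move=> mps mf ps0 f0 ps1 n0 l0 ln2 null kl.
(* [G] fails only on the null set. It holds trivially where [ps] vanishes, and there the integrands
   below are 0. *)
pose G y := ~~ ((0 < ps y) && ~~ (expR (- n) * ps y <= f y <= expR n * ps y)).
have mq := measurable_fun_div f0 mps mf.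
have mlnq : measurable_fun setT (fun y => ps y * ln (ps y / f y)).
  by apply: measurable_funM => //; exact: measurableT_comp (@measurable_ln R) mq.
have mG : measurable_fun setT G.
  apply: measurable_neg; apply: measurable_and; first exact: measurable_fun_ltr.
  apply: measurable_neg; apply: measurable_and; apply: measurable_fun_ler => //;
  exact: measurable_funM.
have aeG (h : Y -> R) : measurable_fun setT h ->
  (\int[nu]_y (h y)%:E = \int[nu]_y (if G y then h y else 0)%:E)%E.
  move=> mh; apply: ae_eq_integral => //.
  - exact/measurable_EFinP.
  - by apply/measurable_EFinP; exact: measurable_fun_ifT.
  - exists [set y | ~~ G y]; split.
    + by apply: measurable_pred; exact: measurable_neg.
    + by rewrite -null; congr (nu _); apply/seteqP; split => y /=; rewrite /G negbK.
    + by move=> y /= ne; apply/negP => Gy; apply: ne => _; rewrite Gy.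
rewrite aeG; last by apply: measurable_funM => //; exact: measurable_fun_powR.
rewrite aeG// in kl.
set h := fun y => if G y then ps y * ln (ps y / f y) else 0 in kl.
set c := 1 + 2 * l ^+ 2 * n ^+ 2.
have mh : measurable_fun setT h by exact: measurable_fun_ifT.
have hX y : 0 < ps y -> G y -> 0 < f y /\ `|ln (ps y / f y)| <= n.
  move=> p0; rewrite /G p0/= negbK => /andP[h1 h2].
  have fy0 : 0 < f y by apply: lt_le_trans h1; rewrite mulr_gt0 ?expR_gt0.
  split=> //; rewrite ler_norml ln_div ?posrE//; apply/andP; split.
    have : ln (f y) <= ln (expR n * ps y) by rewrite ler_ln ?posrE ?mulr_gt0 ?expR_gt0.
    by rewrite lnM ?posrE ?expR_gt0// expRK; lra.
  have : ln (expR (- n) * ps y) <= ln (f y).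
    by rewrite ler_ln ?posrE ?mulr_gt0 ?expR_gt0.
  by rewrite lnM ?posrE ?expR_gt0// expRK; lra.
have ips : nu.-integrable setT (fun y => (ps y)%:E).
  apply/integrableP; split; first exact/measurable_EFinP.
  by under eq_integral do rewrite gee0_abs ?lee_fin//; rewrite ps1 ltry.
have ih : nu.-integrable setT (fun y => (h y)%:E).
  apply: (@le_integrable _ _ _ _ _ _ _ (fun y => n%:E * (ps y)%:E)%E) => //.
  - exact/measurable_EFinP.
  - move=> y _; rewrite -EFinM /= lee_fin /h.
    case: ifPn => Gy; last by rewrite normr0.
    have [p0|] := ltP 0 (ps y); last first.
      by move=> p0; rewrite (_ : ps y = 0) ?mul0r ?normr0//; apply/le_anti; rewrite p0 ps0.
    by rewrite !normrM (ger0_norm n0) mulrC ler_wpM2r// (hX _ p0 Gy).2.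
  - exact: integrableZl.
apply: (@le_trans _ _ (\int[nu]_y (c%:E * (ps y)%:E + l%:E * (h y)%:E))%E).
  apply: ge0_le_integral => //.
  - by move=> y _; rewrite lee_fin; case: ifP => // _; rewrite mulr_ge0 ?powR_ge0.
  - apply/measurable_EFinP; apply: measurable_fun_ifT => //.
    by apply: measurable_funM => //; exact: measurable_fun_powR.
  - by apply: emeasurable_funD; apply: emeasurable_funM => //; exact/measurable_EFinP.
  - move=> y _; rewrite -!EFinM -EFinD lee_fin /h /c; case: ifPn => Gy; last first.
      rewrite mulr0 addr0 mulr_ge0 ?ps0// -mulrA; have : 0 <= l ^+ 2 * n ^+ 2 by rewrite mulr_ge0 ?sqr_ge0.
      by move=> ?; lra.
    have [p0|] := ltP 0 (ps y); last first.
      by move=> p0; rewrite (_ : ps y = 0) ?mul0r ?mulr0 ?addr0//; apply/le_anti; rewrite p0 ps0.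
    have [fy0 lnn] := hX _ p0 Gy.
    rewrite /powR gt_eqF ?divr_gt0//.
    set X := ln _ in lnn *.
    have lX : l * X <= 1/2.
      by apply: le_trans ln2; rewrite ler_pM2l//; apply: le_trans lnn; exact: ler_norm.
    have X2 : X ^+ 2 <= n ^+ 2 by rewrite -[X ^+ 2]real_normK ?num_real// ler_sqr ?nnegrE.
    have := expR_le_quad lX; rewrite exprMn => h1.
    have : l ^+ 2 * X ^+ 2 <= l ^+ 2 * n ^+ 2 by rewrite ler_wpM2l ?sqr_ge0.
    by move=> h2; nra.
rewrite integralD//; last 2 first.
- exact: integrableZl.
- exact: integrableZl.
rewrite !integralZl// ps1 mule1.
have : (l%:E * \int[nu]_y (h y)%:E <= l%:E * e%:E)%E by apply: lee_wpmul2l => //; rewrite lee_fin ltW.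
move=> /(leeD2l c%:E) /le_trans; apply.
by rewrite -EFinM -EFinD lee_fin /c; lra.
Qed.

End tilted.

Section ae_section.
Context d1 d2 (T1 : measurableType d1) (T2 : measurableType d2) (R : realType).
Variables (m1 : {sigma_finite_measure set T1 -> \bar R})
          (m2 : {sigma_finite_measure set T2 -> \bar R}).

(** By Tonelli, [Z] is null for the product measure, which is also the integral of its other
    sections. *)
Lemma ae_ysection_null (Z : set (T1 * T2)) : measurable Z ->
  (forall x, m2 (xsection Z x) = 0) -> {ae m2, forall y, m1 (ysection Z y) = 0}.
Proof.
move=> mZ Z0; have := indic_fubini_tonelli m1 m2 mZ.
rewrite indic_fubini_tonelli_FE// indic_fubini_tonelli_GE//.
rewrite integral0_eq; last by move=> x _ /=; exact: Z0.
move=> /esym I0.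
have /(ae_eq_integral_abs m2 measurableT) : (\int[m2]_y `|(m1 \o ysection Z) y| = 0)%E.
  by rewrite -[RHS]I0; apply: eq_integral => y _; rewrite gee0_abs.
move=> /(_ (measurable_fun_ysection m1 mZ)).
by apply: filterS => y /(_ I).
Qed.

End ae_section.

Section bayes_step.
Context d1 d2 (T : measurableType d1) (Y : measurableType d2) (R : realType).
Variables (m1 : {sigma_finite_measure set T -> \bar R})
          (nu : {sigma_finite_measure set Y -> \bar R}).
Variable f : T * Y -> R.
Hypotheses (mf : measurable_fun setT f) (f0 : forall z, 0 <= f z)
  (f1 : forall th, (\int[nu]_y (f (th, y))%:E = 1)%E).
Variable ps : Y -> R.
Hypotheses (mps : measurable_fun setT ps) (ps0 : forall y, 0 <= ps y)
  (ps1 : (\int[nu]_y (ps y)%:E = 1)%E).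

Let mf1 th : measurable_fun setT (fun y => f (th, y)).
Proof. exact: measurableT_comp mf (pair1_measurable th). Qed.

Let mf2 y : measurable_fun setT (fun th => f (th, y)).
Proof. exact: measurableT_comp mf (pair2_measurable y). Qed.

Let mfst (g : T -> R) : measurable_fun setT g -> measurable_fun setT (fun z : T * Y => g z.1).
Proof. by move=> mg; exact: measurableT_comp mg measurable_fst. Qed.

Let msnd (g : Y -> R) : measurable_fun setT g -> measurable_fun setT (fun z : T * Y => g z.2).
Proof. by move=> mg; exact: measurableT_comp mg measurable_snd. Qed.

Let mixture_measurable (a : T -> R) (qa : Y -> R) :
  measurable_fun setT a -> (forall th, 0 <= a th) ->
  (forall y, (qa y)%:E = \int[m1]_th (a th * f (th, y))%:E)%E ->
  measurable_fun setT qa.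
Proof.
move=> ma a0 qaE; apply/measurable_EFinP.
rewrite (_ : _ \o _ = fubini_G m1 (fun z : T * Y => (a z.1 * f z)%:E)); last first.
  by apply/funext => y /=; rewrite qaE.
apply: measurable_fun_fubini_tonelli_G.
  by apply/measurable_EFinP; apply: measurable_funM => //; exact: mfst.
by move=> z; rewrite lee_fin mulr_ge0.
Qed.

(** The bounds on [f] hold, for each parameter, outside a null set depending on it; Tonelli makes
    them hold, for almost every [y], at almost every parameter. The bound on the power is then
    Jensen's inequality under the weights [b]. *)
Lemma mixture_lower (b : T -> R) (qb : Y -> R) (n l : R) :
  measurable_fun setT b -> (forall th, 0 <= b th) ->
  (\int[m1]_th (b th)%:E = 1)%E ->
  (forall y, (qb y)%:E = \int[m1]_th (b th * f (th, y))%:E)%E ->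
  0 < l ->
  (forall th, 0 < b th -> nu [set y | (0 < ps y) &&
     ~~ (expR (- n) * ps y <= f (th, y) <= expR n * ps y)] = 0) ->
  {ae nu, forall y, 0 < ps y -> expR (- n) * ps y <= qb y /\
    (((ps y / qb y) `^ l)%:E <= \int[m1]_th (b th * (ps y / f (th, y)) `^ l)%:E)%E}.
Proof.
move=> mb b0 b1 qbE l0 Hn.
pose bad (z : T * Y) := (0 < b z.1) && ((0 < ps z.2) &&
     ~~ (expR (- n) * ps z.2 <= f z <= expR n * ps z.2)).
have mbad : measurable_fun setT bad.
  apply: measurable_and; first by apply: measurable_fun_ltr => //; exact: mfst.
  apply: measurable_and; first by apply: measurable_fun_ltr => //; exact: msnd.
  apply: measurable_neg; apply: measurable_and; apply: measurable_fun_ler => //;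
    by apply: measurable_funM => //; exact: msnd.
have mZ : measurable [set z | bad z] by exact: measurable_pred.
have := @ae_ysection_null _ _ _ _ _ m1 nu _ mZ.
have Hx th : nu (xsection [set z | bad z] th) = 0.
  have [bt|bt] := ltP 0 (b th).
    rewrite -(Hn th bt); congr (nu _); apply/seteqP; split => y; rewrite /xsection/= inE/= /bad/= bt//.
  rewrite (_ : xsection _ _ = set0) ?measure0//.
  by apply/seteqP; split => y //; rewrite /xsection/= inE/= /bad/= ltNge bt.
move=> /(_ Hx); apply: filterS => y Zy p0.
have aegood (g1 g2 : T -> R) : measurable_fun setT g1 -> measurable_fun setT g2 ->
  (forall th, 0 <= g1 th) -> (forall th, 0 <= g2 th) ->
  (forall th, (0 < b th -> expR (- n) * ps y <= f (th, y) /\ 0 < f (th, y)) -> g1 th <= g2 th) ->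
  (\int[m1]_th (g1 th)%:E <= \int[m1]_th (g2 th)%:E)%E.
  move=> mg1 mg2 g10 g20 g12; apply: ae_ge0_le_integral => //.
  - by move=> th _; rewrite lee_fin.
  - exact/measurable_EFinP.
  - by move=> th _; rewrite lee_fin.
  - exact/measurable_EFinP.
  - exists (ysection [set z | bad z] y); split => //; first exact: measurable_ysection.
    move=> th /= ne; rewrite /ysection/= inE/= /bad/=.
    apply/negPn/negP => nb; apply: ne => _; rewrite lee_fin; apply: g12 => bt.
    move: nb; rewrite bt p0/= negbK => /andP[h _]; split => //.
    by apply: lt_le_trans h; rewrite mulr_gt0 ?expR_gt0.
have low : expR (- n) * ps y <= qb y.
  rewrite -lee_fin qbE.
  apply: (@le_trans _ _ (\int[m1]_th (b th * (expR (- n) * ps y))%:E)%E).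
    under eq_integral do rewrite mulrC EFinM.
    by rewrite integralZl//= ?b1 ?mule1//; apply/integrableP; split;
      [exact/measurable_EFinP|under eq_integral do rewrite gee0_abs ?lee_fin//; rewrite b1 ltry].
  apply: aegood.
  - exact: measurable_funM.
  - exact: measurable_funM.
  - by move=> th; rewrite !mulr_ge0 ?expR_ge0.
  - by move=> th; rewrite mulr_ge0.
  - move=> th h; have [bt|bt] := ltP 0 (b th).
      by rewrite ler_wpM2l//; apply: (h bt).1.
    by rewrite (_ : b th = 0) ?mul0r//; apply/le_anti; rewrite bt b0.
split=> //.
have qb0 : 0 < qb y by apply: lt_le_trans low; rewrite mulr_gt0 ?expR_gt0.
set c := (ps y / qb y) `^ l.
have c0 : 0 <= c by exact: powR_ge0.
have mpf : measurable_fun setT (fun th => (ps y / f (th, y)) `^ l).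
  by apply: measurable_fun_powR; apply: measurable_fun_div.
have ib : m1.-integrable setT (fun th => (b th)%:E).
  by apply/integrableP; split;
    [exact/measurable_EFinP|under eq_integral do rewrite gee0_abs ?lee_fin//; rewrite b1 ltry].
(* The tangent [1 + l - l * t] at [t = f / qb] averages to 1 because [f / qb] does; adding [l * c]
   to both sides keeps the integrands nonnegative. *)
suff : (((1 + l) * c)%:E <= \int[m1]_th (b th * (ps y / f (th, y)) `^ l)%:E + (l * c)%:E)%E.
  by rewrite mulrDl mul1r EFinD leeD2rE.
have -> : ((1 + l) * c)%:E = (\int[m1]_th (((1 + l) * c) * b th)%:E)%E.
  by under eq_integral do rewrite EFinM; rewrite integralZl// b1 mule1.
have -> : ((l * c)%:E = \int[m1]_th ((l * c / qb y) * (b th * f (th, y)))%:E)%E.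
  under eq_integral do rewrite EFinM.
  rewrite ge0_integralZl_EFin//.
  - by rewrite -qbE -EFinM divfK// gt_eqF.
  - by move=> th _; rewrite lee_fin mulr_ge0.
  - by apply/measurable_EFinP; exact: measurable_funM.
  - by rewrite !mulr_ge0 ?invr_ge0// ltW.
rewrite -ge0_integralD//; last 4 first.
- by move=> th _; rewrite lee_fin mulr_ge0 ?powR_ge0.
- by apply/measurable_EFinP; exact: measurable_funM.
- by move=> th _; rewrite lee_fin !mulr_ge0 ?invr_ge0// ltW.
- by apply/measurable_EFinP; do 2 apply: measurable_funM => //.
under [leRHS]eq_integral do rewrite -EFinD.
apply: aegood.
- exact: measurable_funM.
- by apply: measurable_funD; do 2 ?apply: measurable_funM => //.
- by move=> th; rewrite !mulr_ge0// addr_ge0// ltW.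
- by move=> th; rewrite addr_ge0// !mulr_ge0 ?powR_ge0 ?invr_ge0// ltW.
move=> th h; have [bt|bt] := ltP 0 (b th); last first.
  by rewrite (_ : b th = 0) ?mul0r ?mulr0 ?addr0//; apply/le_anti; rewrite bt b0.
have [_ fy0] := h bt.
have -> : (ps y / f (th, y)) `^ l = c * (((f (th, y) / qb y)^-1) `^ l).
  rewrite /c -powRM ?invr_ge0 ?divr_ge0 ?(ltW qb0)//.
  by congr (_ `^ _); field; rewrite !gt_eqF.
have t0 : 0 < f (th, y) / qb y by rewrite divr_gt0.
have := powRN_ge_tangent t0 l0; set u := _ `^ l => hu.
have -> : l * c / qb y * (b th * f (th, y)) = b th * c * (l * (f (th, y) / qb y)) by ring.
have : 0 <= b th * c * (u - (1 + l - l * (f (th, y) / qb y))).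
  by rewrite mulr_ge0 ?subr_ge0// mulr_ge0.
by lra.
Qed.

(* With [w = 1 + e / 2] on the test event [A] and [w = 1] off [A], the ratio [qa / qb]
   is [qa / (w ps)] times [w (ps / qb)]: the tangent inequality makes the first
   factor gain on [A], and the second costs at most the KL bound [e ^+ 2 / 8]. *)
Lemma bayes_odds_step (a b : T -> R) (qa qb : Y -> R) (A : set Y) (pA e n l : R) :
  measurable_fun setT a -> (forall th, 0 <= a th) ->
  (\int[m1]_th (a th)%:E = 1)%E ->
  (forall y, (qa y)%:E = \int[m1]_th (a th * f (th, y))%:E)%E ->
  measurable_fun setT b -> (forall th, 0 <= b th) ->
  (\int[m1]_th (b th)%:E = 1)%E ->
  (forall y, (qb y)%:E = \int[m1]_th (b th * f (th, y))%:E)%E ->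
  measurable A -> (\int[nu]_(y in A) (ps y)%:E = pA%:E)%E ->
  0 < e -> pA + e <= 1 ->
  (forall th, (0 < a th)%R -> (pA + e)%:E <= \int[nu]_(y in A) (f (th, y))%:E)%E ->
  0 <= n ->
  (forall th, 0 < b th -> nu [set y | (0 < ps y) &&
     ~~ (expR (- n) * ps y <= f (th, y) <= expR n * ps y)] = 0) ->
  (forall th, (0 < b th)%R ->
     \int[nu]_y (ps y * ln (ps y / f (th, y)))%:E <= (e ^+ 2 / 8)%:E)%E ->
  l = e ^+ 2 / (48 * (n + 1) ^+ 2) ->
  (\int[nu]_y (ps y * (qa y / qb y) `^ l)%:E <= 1)%E.
Proof.
move=> ma a0 a1 qaE mb b0 b1 qbE mA pAE e0 pAe HA n0 Hn Hkl lE.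
have mqa := mixture_measurable ma a0 qaE.
have mqb := mixture_measurable mb b0 qbE.
have qa0 y : 0 <= qa y.
  by rewrite -lee_fin qaE; apply: integral_ge0 => th _; rewrite lee_fin mulr_ge0.
have qb0 y : 0 <= qb y.
  by rewrite -lee_fin qbE; apply: integral_ge0 => th _; rewrite lee_fin mulr_ge0.
have pA0 : 0 <= pA.
  by rewrite -lee_fin -pAE; apply: integral_ge0 => y _; rewrite lee_fin.
have e1 : e <= 1 by lra.
set N := n + 1 in lE.
have N1 : 1 <= N by rewrite /N; lra.
have N0 : 0 < N by lra.
have l0 : 0 < l by rewrite lE divr_gt0 ?mulr_gt0 ?exprn_gt0.
have lN2 : l * N ^+ 2 = e ^+ 2 / 48 by rewrite lE; field; rewrite gt_eqF.
have lN : l * N <= 1/2.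
  have : l * N <= l * N ^+ 2 by rewrite ler_pM2l//; nra.
  by rewrite lN2; nra.
have l1 : l <= 1 by nra.
have ln2 : l * n <= 1/2 by apply: le_trans lN; rewrite ler_pM2l// /N; lra.
set tau := e / 2.
have t0 : 0 < tau by rewrite /tau; lra.
have t1 : tau <= 1 by rewrite /tau; lra.
pose K := 1 + 2 * (l * N).
have K0 : 0 <= K by rewrite /K addr_ge0 ?mulr_ge0// ltW.
have c2 : 0 <= (1 - l) * (l * tau * K).
  by apply: mulr_ge0; [rewrite subr_ge0|apply: mulr_ge0 => //; apply: mulr_ge0; exact: ltW].
have c3 : 0 <= l * K by apply: mulr_ge0 => //; exact: ltW.
pose w y := if y \in A then 1 + tau else 1.
have w0 y : 0 < w y by rewrite /w; case: ifP => _; lra.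
have mAb : measurable_fun setT (fun y => y \in A) by exact: measurable_mem.
have mw : measurable_fun setT w by exact: measurable_fun_ifT.
pose psA y := if y \in A then ps y else 0.
have mpsA : measurable_fun setT psA by exact: measurable_fun_ifT.
have psA0 y : 0 <= psA y by rewrite /psA; case: ifP.
pose g (z : T * Y) := ps z.2 * (b z.1 * (ps z.2 / f z) `^ l).
have mg : measurable_fun setT g.
  apply: measurable_funM; first exact: msnd.
  apply: measurable_funM; first exact: mfst.
  by apply: measurable_fun_powR; apply: measurable_fun_div => //; exact: msnd.
have g0 z : 0 <= g z by rewrite !mulr_ge0 ?powR_ge0.
pose J y := (\int[m1]_th (g (th, y))%:E)%E.
have mJ : measurable_fun setT J.
  apply: (@measurable_fun_fubini_tonelli_G _ _ _ _ _ m1 (EFin \o g)).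
    exact/measurable_EFinP.
  by move=> z; rewrite lee_fin.
have J0 y : (0 <= J y)%E by apply: integral_ge0 => th _; rewrite lee_fin.
have mps_pf th : measurable_fun setT (fun y => ps y * (ps y / f (th, y)) `^ l).
  by apply: measurable_funM => //; apply: measurable_fun_powR; exact: measurable_fun_div.
(* Tonelli puts the integral in [y] inside, where [tilted_moment] applies to each parameter charged
   by [b]. *)
have IJ : (\int[nu]_y J y <= (1 + l * (e ^+ 2 / 8) + 2 * l ^+ 2 * n ^+ 2)%:E)%E.
  set M := (X in (_ <= X%:E)%E).
  rewrite -(@fubini_tonelli _ _ _ _ _ m1 nu (EFin \o g)); last 2 first.
  - exact/measurable_EFinP.
  - by move=> z; rewrite lee_fin.
  have M0 : 0 <= M.
    rewrite /M; apply: addr_ge0.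
      by apply: addr_ge0 => //; rewrite mulr_ge0 ?divr_ge0 ?sqr_ge0// ltW.
    by rewrite -mulrA mulr_ge0// mulr_ge0 ?sqr_ge0.
  apply: (@le_trans _ _ (\int[m1]_th (M%:E * (b th)%:E))%E); last first.
    rewrite ge0_integralZl_EFin//; last 2 first.
    - by move=> th _; rewrite lee_fin.
    - exact/measurable_EFinP.
    by rewrite b1 mule1.
  apply: ge0_le_integral => //.
  - by move=> th _; apply: integral_ge0 => y _; rewrite lee_fin.
  - apply: (@measurable_fun_fubini_tonelli_F _ _ _ _ _ nu (EFin \o g)).
      exact/measurable_EFinP.
    by move=> z; rewrite lee_fin.
  - by apply: emeasurable_funM => //; exact/measurable_EFinP.
  move=> th _.
  have -> : (\int[nu]_y (EFin \o g) (th, y) =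
     (b th)%:E * \int[nu]_y (ps y * (ps y / f (th, y)) `^ l)%:E)%E.
    rewrite -ge0_integralZl_EFin//; last 2 first.
    - by move=> y _; rewrite lee_fin mulr_ge0 ?powR_ge0.
    - exact/measurable_EFinP.
    by apply: eq_integral => y _; rewrite -EFinM /g /=; congr EFin; ring.
  have [bt|bt] := ltP 0 (b th); last first.
    by rewrite (_ : b th = 0) ?mul0e ?mule0//; apply/le_anti; rewrite bt b0.
  rewrite muleC; apply: lee_wpmul2r; first by rewrite lee_fin.
  by apply: tilted_moment => //; [exact: Hn|exact: Hkl].
have IpsA : (\int[nu]_y (psA y)%:E = pA%:E)%E.
  rewrite -pAE [RHS]integral_mkcond; apply: eq_integral => y _.
  by rewrite /psA patchE; case: ifP.
have mqw : measurable_fun setT (fun y => qa y / w y).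
  by apply: measurable_fun_div => // y; rewrite ltW.
have qw0 y : 0 <= qa y / w y by rewrite divr_ge0// ltW.
have mfw th : measurable_fun setT (fun y => f (th, y) / w y).
  by apply: measurable_fun_div => // y; rewrite ltW.
(* [f / w] integrates to 1 minus [tau / (1 + tau)] times the mass of [A], which is at least [pA + e]
   for each parameter charged by [a]; averaging over [a] keeps the bound. *)
have Iqw : (\int[nu]_y (qa y / w y)%:E <= (1 - e / 2 * (pA + e / 2))%:E)%E.
  set M := (X in (_ <= X%:E)%E).
  have M0 : 0 <= M by rewrite /M; nra.
  pose h (z : T * Y) := a z.1 * (f z / w z.2).
  have mh : measurable_fun setT h.
    apply: measurable_funM; first exact: mfst.
    by apply: measurable_fun_div => //; [move=> z; rewrite ltW|exact: msnd].
  have h0 z : 0 <= h z by rewrite mulr_ge0// divr_ge0// ltW.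
  have -> : (\int[nu]_y (qa y / w y)%:E = \int[nu]_y \int[m1]_th (EFin \o h) (th, y))%E.
    apply: eq_integral => y _; rewrite mulrC EFinM qaE -ge0_integralZl_EFin//; last 3 first.
    - by move=> th _; rewrite lee_fin mulr_ge0.
    - by apply/measurable_EFinP; exact: measurable_funM.
    - by rewrite invr_ge0 ltW.
    by apply: eq_integral => th _; rewrite -EFinM /h /=; congr EFin; ring.
  rewrite -(@fubini_tonelli _ _ _ _ _ m1 nu (EFin \o h)); last 2 first.
  - exact/measurable_EFinP.
  - by move=> z; rewrite lee_fin.
  apply: (@le_trans _ _ (\int[m1]_th (M%:E * (a th)%:E))%E); last first.
    rewrite ge0_integralZl_EFin//; last 2 first.
    - by move=> th _; rewrite lee_fin.
    - exact/measurable_EFinP.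
    by rewrite a1 mule1.
  apply: ge0_le_integral => //.
  - by move=> th _; apply: integral_ge0 => y _; rewrite lee_fin.
  - apply: (@measurable_fun_fubini_tonelli_F _ _ _ _ _ nu (EFin \o h)).
      exact/measurable_EFinP.
    by move=> z; rewrite lee_fin.
  - by apply: emeasurable_funM => //; exact/measurable_EFinP.
  move=> th _.
  have -> : (\int[nu]_y (EFin \o h) (th, y) =
     (a th)%:E * \int[nu]_y (f (th, y) / w y)%:E)%E.
    rewrite -ge0_integralZl_EFin//; last 2 first.
    - by move=> y _; rewrite lee_fin divr_ge0// ltW.
    - exact/measurable_EFinP.
  have [at0|at0] := ltP 0 (a th); last first.
    by rewrite (_ : a th = 0) ?mul0e ?mule0//; apply/le_anti; rewrite at0 a0.
  rewrite muleC; apply: lee_wpmul2r; first by rewrite lee_fin.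
  pose k := tau / (1 + tau).
  have k0 : 0 <= k by apply: divr_ge0; lra.
  pose fA y := if y \in A then f (th, y) else 0.
  have fA0 y : 0 <= fA y by rewrite /fA; case: ifP.
  have mfA : measurable_fun setT fA by exact: measurable_fun_ifT.
  have sumE : (\int[nu]_y (f (th, y) / w y)%:E + k%:E * \int[nu]_y (fA y)%:E = 1)%E.
    rewrite -ge0_integralZl_EFin//; last 2 first.
    - by move=> y _; rewrite lee_fin.
    - exact/measurable_EFinP.
    rewrite -ge0_integralD//; last 4 first.
    - by move=> y _; rewrite lee_fin divr_ge0// ltW.
    - exact/measurable_EFinP.
    - by move=> y _; rewrite -EFinM lee_fin mulr_ge0.
    - by apply: emeasurable_funM => //; exact/measurable_EFinP.
    rewrite -(f1 th); apply: eq_integral => y _; rewrite -EFinM -EFinD; congr EFin.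
    by rewrite /fA /w /k; case: ifP => _; [field; rewrite gt_eqF//; lra|rewrite mulr0 addr0 divr1].
  have fAE : (\int[nu]_y (fA y)%:E = \int[nu]_(y in A) (f (th, y))%:E)%E.
    rewrite [RHS]integral_mkcond; apply: eq_integral => y _.
    by rewrite /fA patchE; case: ifP.
  (* Since [e = 2 * tau], this amounts to [pA + tau <= 1]. *)
  have kz : tau * (pA + tau) <= k * (pA + e).
    rewrite /k -mulrA; apply: ler_wpM2l; first exact: ltW.
    rewrite ler_pdivlMl; last by lra.
    by rewrite /tau; nra.
  have hk : ((tau * (pA + tau))%:E <= k%:E * \int[nu]_y (fA y)%:E)%E.
    apply: (@le_trans _ _ (k%:E * (pA + e)%:E)%E); first by rewrite -EFinM lee_fin.
    by apply: lee_wpmul2l; rewrite ?lee_fin// fAE; exact: HA.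
  rewrite -(@leeD2rE _ (tau * (pA + tau))%:E)// /M -EFinD.
  rewrite (_ : 1 - _ + _ = 1 :> R); last by rewrite /tau; ring.
  by rewrite -[leRHS]sumE leeD2l.
apply: (@le_trans _ _ (\int[nu]_y ((1 - l)%:E * J y + ((1 - l) * (l * tau * K))%:E * (psA y)%:E
    + (l * K)%:E * (qa y / w y)%:E))%E).
  apply: ae_ge0_le_integral => //.
  - by move=> y _; rewrite lee_fin mulr_ge0// powR_ge0.
  - apply/measurable_EFinP; apply: measurable_funM => //.
    by apply: measurable_fun_powR; apply: measurable_fun_div.
  - move=> y _; rewrite !adde_ge0//.
    + by rewrite mule_ge0// lee_fin subr_ge0.
    + by rewrite -EFinM lee_fin (mulr_ge0 c2).
    + by rewrite -EFinM lee_fin (mulr_ge0 c3).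
  - apply: emeasurable_funD; last by apply: emeasurable_funM => //; exact/measurable_EFinP.
    apply: emeasurable_funD; apply: emeasurable_funM => //; exact/measurable_EFinP.
  - have := mixture_lower mb b0 b1 qbE l0 Hn; apply: filterS => y Hy _.
    have [p0|p0] := ltP 0 (ps y); last first.
      rewrite (_ : ps y = 0) ?mul0r; last by apply/le_anti; rewrite p0 ps0.
      rewrite !adde_ge0//.
      + by rewrite mule_ge0// lee_fin subr_ge0.
      + by rewrite -EFinM lee_fin (mulr_ge0 c2).
      + by rewrite -EFinM lee_fin (mulr_ge0 c3).
    have [low hJ] := Hy p0.
    have := odds_pointwise (y \in A) p0 (qa0 y) low (ltW t0) t1 n0 l0 l1 lN erefl.
    rewrite -/N -/K -/(w y) -/(psA y) => hp.
    apply: (@le_trans _ _ ((1 - l)%:E * (ps y * (ps y / qb y) `^ l)%:E + ((1 - l) * (l * tau * K))%:E * (psA y)%:E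
    + (l * K)%:E * (qa y / w y)%:E))%E; first by rewrite -!EFinM -!EFinD lee_fin.
    do 2 apply: leeD2r.
    apply: lee_wpmul2l; first by rewrite lee_fin subr_ge0.
    rewrite EFinM /J /g /=; under [leRHS]eq_integral do rewrite EFinM.
    rewrite ge0_integralZl_EFin//.
    + by apply: lee_wpmul2l; rewrite ?lee_fin.
    + by move=> th _; rewrite lee_fin mulr_ge0 ?powR_ge0.
    + apply/measurable_EFinP; apply: measurable_funM => //.
      by apply: measurable_fun_powR; apply: measurable_fun_div.
rewrite ge0_integralD//; last 4 first.
- move=> y _; rewrite adde_ge0//.
  + by rewrite mule_ge0// lee_fin subr_ge0.
  + by rewrite -EFinM lee_fin (mulr_ge0 c2).
- by apply: emeasurable_funD; apply: emeasurable_funM => //; exact/measurable_EFinP.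
- by move=> y _; rewrite -EFinM lee_fin (mulr_ge0 c3).
- by apply: emeasurable_funM => //; exact/measurable_EFinP.
rewrite ge0_integralD//; last 4 first.
- by move=> y _; rewrite mule_ge0// lee_fin subr_ge0.
- exact: emeasurable_funM.
- by move=> y _; rewrite -EFinM lee_fin (mulr_ge0 c2).
- by apply: emeasurable_funM => //; exact/measurable_EFinP.
rewrite (ge0_integralZl_EFin _ _ (fun y _ => J0 y))//; last by rewrite subr_ge0.
rewrite ge0_integralZl_EFin//; last 2 first.
- by move=> y _; rewrite lee_fin.
- exact/measurable_EFinP.
rewrite ge0_integralZl_EFin//; last 2 first.
- by move=> y _; rewrite lee_fin.
- exact/measurable_EFinP.
rewrite IpsA.
have nN : n <= N by rewrite /N; lra.
have := odds_step_arith e0 N1 n0 nN pA0 pAe lE.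
have -> : forall u v : R, (1 - l) * (u + l * (e / 2) * (1 + 2 * (l * N)) * pA) + v =
    (1 - l) * u + (1 - l) * (l * tau * K) * pA + v by move=> u v; rewrite /tau /K; ring.
rewrite -lee_fin; apply: le_trans; rewrite [leRHS]EFinD; apply: leeD; first (rewrite [leRHS]EFinD; apply: leeD).
- by rewrite EFinM; apply: lee_wpmul2l => //; rewrite lee_fin subr_ge0.
- by rewrite -EFinM.
- by rewrite [leRHS]EFinM; apply: lee_wpmul2l; rewrite ?lee_fin.
Qed.

End bayes_step.

(** * Adaptive sampling and supermartingales *)

Section finite_transfer.
Context dO (Om : measurableType dO) (R : realType) (P : probability Om R).
Context dY (Y : measurableType dY) (Q : probability Y R).
Variable G : set (set Om).
Hypothesis GM : forall A, <<s G >> A -> measurable A.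
Let W : measurableType _ := g_sigma_algebraType G.

Let id_meas : measurable_fun setT (idfun : Om -> W).
Proof. by move=> _ A mA; rewrite setTI; exact: GM. Qed.

(** On [A0] the variable [Z] has law [Q] and is independent of [<<s G >>]: the law of [(w, Z w)]
    restricted to [A0] agrees with a product measure on rectangles, hence everywhere, and Tonelli
    concludes. Restricting to [A0] allows the law of the observation to depend on the design
    sampled. *)
Lemma integral_independent_observation (Z : Om -> Y) (A0 : set Om)
    (h : W * Y -> \bar R) :
  measurable_fun setT Z -> <<s G >> A0 ->
  (forall A B, <<s G >> A -> A `<=` A0 -> measurable B ->
     P (A `&` Z @^-1` B) = P A * Q B)%E ->
  measurable_fun setT h -> (forall z, 0 <= h z)%E ->
  (\int[P]_(w in A0) h (w, Z w) = \int[P]_(w in A0) \int[Q]_y h (w, y))%E.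
Proof.
move=> mZ GA0 ind mh h0.
have mA0 : measurable A0 by exact: GM.
have mA0' : measurable (A0 : set W) by [].
pose g : W -> R := \1_A0.
have mg : measurable_fun setT g by exact: measurable_indic.
have g0 w : 0 <= g w by rewrite /g indicE.
have mgO : measurable_fun setT (g : Om -> R) by exact: measurable_indic.
have g0O (w : Om) : 0 <= (g : Om -> R) w by exact: g0.
(* Pushing [P] forward along the identity restricts it to the sub-sigma-field. *)
pose PG0 : {measure set W -> \bar R} := pushforward P (idfun : Om -> W).
pose PG := PG0 id_meas.
pose m1 := mdensity PG mg g0.
have m1E A : measurable A -> m1 A = P (A0 `&` A).
  by move=> mA; rewrite /m1 /mdensity integral_indic.
have fin1 : fin_num_fun m1.
  move=> A mA; rewrite m1E//; apply: fin_num_measure.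
  by apply: measurableI => //; exact: GM.
pose m1f : {finite_measure set W -> \bar R} :=
  HB.pack m1 (Measure_isFinite.Build _ _ _ m1 fin1).
pose phi (w : Om) : W * Y := (w : W, Z w).
have mphi : measurable_fun setT phi.
  by apply: (@measurable_fun_pair _ _ _ Om W Y (fun w => w : W) Z) => //.
pose mO := mdensity P mgO g0O.
pose m'0 : {measure set (W * Y) -> \bar R} := pushforward mO phi.
pose m' := m'0 mphi.
have rect (A : set W) (B : set Y) : measurable A -> measurable B -> m' (A `*` B) = (m1f A * Q B)%E.
  move=> mA mB.
  have -> : m' (A `*` B) = mO (A `&` Z @^-1` B).
    by congr (mO _).
  rewrite /mO /mdensity integral_indic//; last first.
    apply: measurableI; first exact: GM.
    by rewrite -[X in measurable X]setTI; exact: mZ.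
  have -> : m1f A = P (A0 `&` A) by exact: m1E.
  rewrite setIA; apply: ind => //.
  exact: (@measurableI _ W).
have eqm := @product_measure_unique _ _ _ _ R m1f Q m' rect.
have -> : (\int[P]_(w in A0) h (w, Z w) = \int[m']_z h z)%E.
  rewrite ge0_integral_pushforward//.
  rewrite preimage_setT ge0_integral_mdensity; [|exact: measurableT_comp mh mphi|by move=> w; exact: h0].
  rewrite [LHS]integral_mkcond; congr (integral _ _ _); apply/funext => w.
  by rewrite epatch_indic.
have -> : (\int[m']_z h z = \int[m1f \x Q]_z h z)%E.
  by apply: eq_measure_integral => A mA _; apply: esym; exact: eqm.
rewrite fubini_tonelli1//.
have mF : measurable_fun setT (fubini_F Q h) by exact: measurable_fun_fubini_tonelli_F.
have F0 w : (0 <= fubini_F Q h w)%E by exact: integral_ge0.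
rewrite ge0_integral_mdensity//.
rewrite ge0_integral_pushforward//; last 2 first.
  by apply: emeasurable_funM => //; exact/measurable_EFinP.
  by move=> w _; rewrite mule_ge0// lee_fin.
rewrite preimage_setT [RHS]integral_mkcond; congr (integral _ _ _); apply/funext => w.
by rewrite epatch_indic.
Qed.

End finite_transfer.

(** * Ville's maximal inequality for nonnegative supermartingales *)

Section ville.
Context dO (Om : measurableType dO) (R : realType) (P : probability Om R).
Variable G : nat -> set (set Om).
Hypotheses (GM : forall t A, <<s G t >> A -> measurable A)
           (GS : forall t, G t `<=` <<s G t.+1 >>).
Variable S : nat -> Om -> R.
Hypotheses (S0 : forall t w, 0 <= S t w)
  (mS : forall t, measurable_fun setT (S t : g_sigma_algebraType (G t) -> R))
  (supS : forall t A, <<s G t >> A ->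
     (\int[P]_(w in A) (S t.+1 w)%:E <= \int[P]_(w in A) (S t w)%:E)%E).
Variable c : R.
Hypothesis Sc : (\int[P]_w (S 0%N w)%:E <= c%:E)%E.

Let GG t : <<s G t >> `<=` <<s G t.+1 >>.
Proof. apply: smallest_sub; [exact: smallest_sigma_algebra|exact: GS]. Qed.

Let mSO t : measurable_fun setT (S t).
Proof. by move=> _ A mA; apply: (GM (t := t)); exact: mS. Qed.

Let E a t := [set w | forall s, (s < t)%N -> S s w < a].

Let E_S a t : E a t.+1 = E a t `&` [set w | S t w < a].
Proof.
apply/seteqP; split => w /=.
  by move=> h; split; [move=> s st; apply: h; exact: ltnW|exact: h].
by move=> [h1 h2] s; rewrite ltnS leq_eqVlt => /predU1P[->//|]; exact: h1.
Qed.

Let St_lt a t : <<s G t >> [set w | S t w < a].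
Proof.
have : @measurable _ (g_sigma_algebraType (G t)) [set w | S t w < a].
  by apply: measurable_pred; apply: measurable_fun_ltr.
by [].
Qed.

Let G_E a t : <<s G t >> (E a t).
Proof.
elim: t => [|t ih].
  rewrite (_ : E a 0 = setT); last by apply/seteqP; split.
  exact: (@measurableT _ (g_sigma_algebraType (G 0%N))).
rewrite E_S; apply: GG.
by apply: (@measurableI _ (g_sigma_algebraType (G t))); [exact: ih|exact: St_lt].
Qed.

Let mE a t : measurable (E a t).
Proof. by apply: (GM (t := t)); exact: G_E. Qed.

(** Stopping at the first passage above [a]: the left side does not increase with [t], since paths
    crossing at time [t] exchange a value at least [a] for [a], and [supS] covers the paths that
    have not crossed. *)
Let ville_step a t : 0 < a ->
  (a%:E * P (~` E a t) + \int[P]_(w in E a t) (S t w)%:E <= c%:E)%E.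
Proof.
move=> a0; elim: t => [|t ih].
  rewrite (_ : E a 0 = setT); last by apply/seteqP; split.
  by rewrite setCT measure0 mule0 add0e.
apply: le_trans ih.
have mB : measurable [set w | S t w < a] by apply: (GM (t := t)); exact: St_lt.
pose H := E a t `&` ~` [set w | S t w < a].
have mH : measurable H by apply: measurableI => //; exact: measurableC.
have HE : ~` E a t.+1 = ~` E a t `|` H.
  rewrite E_S setCI /H; apply/seteqP; split => w /=.
    by case: (pselect (E a t w)) => ? [?|?]; [right|right|left|left].
  by move=> [?|[? ?]]; [left|right].
rewrite HE measureU//; last 2 first.
  exact: measurableC.
  by apply/seteqP; split => w // -[h [h2 _]].
rewrite muleDr ?ge0_adde_def ?inE//.
have IE : (\int[P]_(w in E a t) (S t w)%:E =
  \int[P]_(w in E a t.+1) (S t w)%:E + \int[P]_(w in H) (S t w)%:E)%E.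
  rewrite -ge0_integral_setU//.
  - congr (integral _ _ _); rewrite E_S /H -setIUr setUv setIT//.
  - by apply/measurable_EFinP; exact: measurable_funTS.
  - by move=> w _; rewrite lee_fin.
  - by rewrite disj_set2E; apply/eqP/seteqP; split => w //; rewrite E_S => -[[_ h] [_ h2]].
rewrite IE -addeA; apply: leeD2l; rewrite addeC; apply: leeD.
  apply: supS; rewrite E_S.
  by apply: (@measurableI _ (g_sigma_algebraType (G t))); [exact: G_E|exact: St_lt].
apply: (@le_trans _ _ (\int[P]_(w in H) (cst a%:E) w)%E).
  by rewrite integral_cst.
apply: ge0_le_integral => //.
- by move=> w _; rewrite lee_fin ltW.
- by apply/measurable_EFinP; exact: measurable_funTS.
- by move=> w [_ /= /negP]; rewrite -leNgt lee_fin.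
Qed.

(** Reaching level [n.+1] has probability at most [c / n.+1], so reaching every level is a null
    event. *)
Lemma supermartingale_ae_bounded :
  {ae P, forall w, exists K : R, forall t, S t w <= K}.
Proof.
have c0 : 0 <= c.
  by rewrite -lee_fin; apply: le_trans Sc; apply: integral_ge0 => w _; rewrite lee_fin.
pose U n := \bigcup_t ~` E n.+1%:R t.
have mU n : measurable (U n) by apply: bigcup_measurable => t _; exact: measurableC.
exists (\bigcap_n U n); split.
- exact: bigcap_measurable.
- apply/eqP; rewrite eq_le measure_ge0 andbT.
  have PU n : (P (U n) <= (c / n.+1%:R)%:E)%E.
    have cv := @nondecreasing_cvg_mu _ _ _ P (fun t => ~` E n.+1%:R t)
       (fun t => measurableC (mE _ t)) (mU n).
    have hom : {homo (fun t => ~` E n.+1%:R t) : n m / (n <= m)%N >-> (n <= m)%O}.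
      move=> s t st; rewrite subsetEset; apply: subsetC => w /= h u us.
      by apply: h; exact: leq_trans us st.
    move: (cv hom) => /cvg_lim <-//.
    apply: lime_le; first by apply/cvg_ex; eexists; exact: cv.
    near=> t.
    have := ville_step t (ltr0Sn R n); rewrite /= => h.
    rewrite -(@lee_pmul2l _ n.+1%:R%:E)// ?lte_fin ?ltr0Sn//.
    rewrite -EFinM mulrC divfK ?pnatr_eq0//.
    apply: le_trans h; rewrite leeDl//.
    by apply: integral_ge0 => w _; rewrite lee_fin.
  have Pc n : (P (\bigcap_n U n) <= (c / n.+1%:R)%:E)%E.
    apply: le_trans (PU n); apply: le_measure; rewrite ?inE//.
      exact: bigcap_measurable.
    exact: bigcap_inf.
  apply/lee_addgt0Pr => e e0; rewrite add0e.
  have [n nc] : exists n : nat, c / e < n.+1%:R.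
    exists (Num.bound (c / e)).
    apply: lt_trans (archi_boundP _) _; first by rewrite divr_ge0// ltW.
    by rewrite ltr_nat.
  apply: le_trans (Pc n) _; rewrite lee_fin ler_pdivrMr ?ltr0Sn//.
  by rewrite mulrC -ler_pdivrMr// ltW.
- move=> w /= nb n _; apply: contrapT => nU; apply: nb; exists n.+1%:R => t.
  rewrite leNgt; apply/negP => lt; apply: nU; exists t.+1 => //= h.
  by have := lt_trans lt (h t (ltnSn t)); rewrite ltxx.
Unshelve. all: by end_near.
Qed.

End ville.

(** * Likelihoods and posterior odds *)

Section likelihood.
Context d1 d2 (T : measurableType d1) (Y : measurableType d2) (R : realType).
Context (Des : finType) (m1 : {finite_measure set T -> \bar R}).
Variable f : T * Y -> R.
Hypotheses (mf : measurable_fun setT f) (f0 : forall z, 0 <= f z)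
  (fbd : forall y, exists K : R, forall th, f (th, y) <= K).

Definition flik (Ds : nat -> Des) (Ys : nat -> Y) t d th : R :=
  \prod_(s < t | Ds s == d) f (th, Ys s).

Lemma flik_ge0 Ds Ys t d th : 0 <= flik Ds Ys t d th.
Proof. by apply: prodr_ge0 => s _. Qed.

Lemma flikS Ds Ys t d th : flik Ds Ys t.+1 d th =
  if Ds t == d then flik Ds Ys t d th * f (th, Ys t) else flik Ds Ys t d th.
Proof.
rewrite /flik big_mkcond big_ord_recr /= -big_mkcond/=.
by case: ifP => _; rewrite ?mulr1.
Qed.

Lemma eq_flik Ds Ds' Ys Ys' t d th :
  (forall s, (s < t)%N -> Ds s = Ds' s /\ Ys s = Ys' s) ->
  flik Ds Ys t d th = flik Ds' Ys' t d th.
Proof.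
move=> h; apply: eq_big => [s|s _]; first by rewrite (h s _).1.
by rewrite (h s _).2.
Qed.

Lemma flik_bounded Ds Ys t d : exists2 K, 0 <= K & forall th, flik Ds Ys t d th <= K.
Proof.
elim: t => [|t [K K0 h]]; first by exists 1 => // th; rewrite /flik big_ord0.
have [L hL] := fbd (Ys t).
exists (K * Num.max L 1); first by rewrite mulr_ge0// le_max ler01 orbT.
move=> th; rewrite flikS; case: ifP => _.
  by apply: ler_pM; rewrite ?flik_ge0// le_max hL.
by apply: le_trans (h th) _; rewrite ler_peMr// le_max lexx orbT.
Qed.

Lemma measurable_flik dW (W : measurableType dW) (D : nat -> W -> Des)
    (Yw : nat -> W -> Y) t d :
  (forall s, (s < t)%N -> measurable (D s @^-1` [set d])) ->
  (forall s, (s < t)%N -> measurable_fun setT (Yw s)) ->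
  measurable_fun setT (fun z : W * T => flik (D ^~ z.1) (Yw ^~ z.1) t d z.2).
Proof.
move=> mD mY; rewrite /flik; under eq_fun do rewrite big_mkcond.
apply: measurable_prod => i _; apply: measurable_fun_ifT => //.
- apply: (measurable_fun_bool true); rewrite setTI.
  rewrite (_ : _ @^-1` _ = (D i @^-1` [set d]) `*` setT); first by apply: measurableX => //; exact: mD.
  by apply/seteqP; split => z /=; [move=> /eqP|move=> [/eqP]].
- apply: (measurableT_comp mf); apply: measurable_fun_pair => //.
  exact: (measurableT_comp (mY i (ltn_ord i)) measurable_fst).
Qed.

Lemma measurable_flik1 Ds Ys t d : measurable_fun setT (flik Ds Ys t d).
Proof.
rewrite /flik; under eq_fun do rewrite big_mkcond.
apply: measurable_prod => i _; case: (Ds i == d) => //.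
exact: measurableT_comp mf (pair2_measurable _).
Qed.

(* Unnormalised posterior mass of [B]. *)
Definition marg (B : set T) Ds Ys t d : \bar R :=
  (\int[m1]_(th in B) (flik Ds Ys t d th)%:E)%E.

Lemma marg_ge0 B Ds Ys t d : (0 <= marg B Ds Ys t d)%E.
Proof. by apply: integral_ge0 => th _; rewrite lee_fin flik_ge0. Qed.

Lemma marg_fin B Ds Ys t d : measurable B -> marg B Ds Ys t d \is a fin_num.
Proof.
move=> mB; have [K K0 h] := flik_bounded Ds Ys t d.
rewrite ge0_fin_numE ?marg_ge0//.
apply: (@le_lt_trans _ _ (\int[m1]_(th in B) (cst K%:E) th)%E).
  apply: ge0_le_integral => //.
  - by move=> th _; rewrite lee_fin flik_ge0.
  - by apply/measurable_EFinP; apply: measurable_funTS; exact: measurable_flik1.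
  - by move=> th _; rewrite lee_fin.
rewrite integral_cst//; apply: lte_mul_pinfty; rewrite ?lee_fin//.
by rewrite -ge0_fin_numE//; exact: fin_num_measure.
Qed.

Lemma margS B Ds Ys t d : marg B Ds Ys t.+1 d =
  if Ds t == d then (\int[m1]_(th in B) (flik Ds Ys t d th * f (th, Ys t))%:E)%E
  else marg B Ds Ys t d.
Proof. by case: ifP => h; apply: eq_integral => th _; rewrite flikS h. Qed.

Lemma measurable_marg dW (W : measurableType dW) (D : nat -> W -> Des)
    (Yw : nat -> W -> Y) B t d : measurable B ->
  (forall s, (s < t)%N -> measurable (D s @^-1` [set d])) ->
  (forall s, (s < t)%N -> measurable_fun setT (Yw s)) ->
  measurable_fun setT (fun w => marg B (D ^~ w) (Yw ^~ w) t d).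
Proof.
move=> mB mD mY.
pose g (z : W * T) := flik (D ^~ z.1) (Yw ^~ z.1) t d z.2 * \1_B z.2.
rewrite (_ : (fun w => _) = fubini_F m1 (EFin \o g)); last first.
  apply/funext => w; rewrite /marg integral_mkcond /fubini_F.
  by congr (integral _ _ _); apply/funext => th; rewrite epatch_indic/= -EFinM.
apply: measurable_fun_fubini_tonelli_F.
  apply/measurable_EFinP; apply: measurable_funM; first exact: measurable_flik.
  by apply: (@measurableT_comp _ _ _ _ _ _ (\1_B : T -> R)) => //; exact: measurable_indic.
by move=> z; rewrite lee_fin mulr_ge0 ?flik_ge0// indicE.
Qed.

Section odds.
Variable nu : {sigma_finite_measure set Y -> \bar R}.
Hypothesis f1 : forall th, (\int[nu]_y (f (th, y))%:E = 1)%E.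
Variable ps : Y -> R.
Hypotheses (mps : measurable_fun setT ps) (ps0 : forall y, 0 <= ps y)
  (ps1 : (\int[nu]_y (ps y)%:E = 1)%E).
Variables (B U : set T) (A : set Y) (pA e n l : R).
Hypotheses (mB : measurable B) (mU : measurable U) (mA : measurable A)
  (pAE : (\int[nu]_(y in A) (ps y)%:E = pA%:E)%E) (e0 : 0 < e) (pAe : pA + e <= 1)
  (HA : forall th, B th -> ((pA + e)%:E <= \int[nu]_(y in A) (f (th, y))%:E)%E)
  (n0 : 0 <= n)
  (Hn : forall th, U th -> nu [set y | (0 < ps y) &&
     ~~ (expR (- n) * ps y <= f (th, y) <= expR n * ps y)] = 0)
  (Hkl : forall th, U th ->
     (\int[nu]_y (ps y * ln (ps y / f (th, y)))%:E <= (e ^+ 2 / 8)%:E)%E)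
  (lE : l = e ^+ 2 / (48 * (n + 1) ^+ 2)).

Definition odds Ds Ys t d : R :=
  (fine (marg B Ds Ys t d) / fine (marg U Ds Ys t d)) `^ l.

(** The value of [odds] at [t.+1] as a function of a hypothetical observation [y] of design [d] at
    step [t]. *)
Definition next_odds Ds Ys t d (y : Y) : R :=
  (fine (\int[m1]_(th in B) (flik Ds Ys t d th * f (th, y))%:E)%E
   / fine (\int[m1]_(th in U) (flik Ds Ys t d th * f (th, y))%:E)%E) `^ l.

Let l0 : 0 < l.
Proof.
have N0 : 0 < n + 1 by apply: ltr_wpDl.
by rewrite lE divr_gt0 ?mulr_gt0 ?exprn_gt0.
Qed.

Let predictive_fin (V : set T) Ds Ys t d y : measurable V ->
  (\int[m1]_(th in V) (flik Ds Ys t d th * f (th, y))%:E)%E \is a fin_num.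
Proof.
move=> mV.
(* Appending a fictitious observation [y] of [d] to the history turns the integral into an
   unnormalised mass at [t.+1]. *)
have := @marg_fin V (fun s => if (s < t)%N then Ds s else d)
  (fun s => if (s < t)%N then Ys s else y) t.+1 d mV.
rewrite margS ltnn eqxx; congr (_ \is a fin_num).
apply: eq_integral => th _; congr (_ * _)%:E.
by apply: eq_flik => s st; rewrite st.
Qed.

Let predictive_zero (V : set T) Ds Ys t d y : measurable V ->
  fine (marg V Ds Ys t d) = 0 ->
  (\int[m1]_(th in V) (flik Ds Ys t d th * f (th, y))%:E)%E = 0%E.
Proof.
move=> mV /eqP; rewrite fine_eq0 ?marg_fin// => /eqP m0.
have mfl := measurable_funTS (D := V) (@measurable_flik1 Ds Ys t d).
have : (\int[m1]_(th in V) `|(flik Ds Ys t d th)%:E| = 0)%E.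
  rewrite -[RHS]m0; apply: eq_integral => th _.
  by rewrite gee0_abs// lee_fin flik_ge0.
move=> /(ae_eq_integral_abs m1 mV) h.
have {}h := h (proj2 (measurable_EFinP _ _) mfl).
have mfy : measurable_fun setT (fun th => f (th, y)).
  exact: measurableT_comp mf (pair2_measurable _).
rewrite (@ae_eq_integral _ _ _ m1 V (cst 0%E))//.
- by rewrite integral0.
- apply/measurable_EFinP; apply: measurable_funM => //.
  exact: measurable_funTS.
- apply: filterS h => th h Vth; have := h Vth => /= -[->].
  by rewrite mul0r.
Qed.

Let ratio_of_weights (NB NU x y : R) : 0 < NB -> 0 < NU -> 0 <= x -> 0 <= y ->
  (x / y) `^ l = (NB / NU) `^ l * ((x / NB) / (y / NU)) `^ l.
Proof.
move=> h1 h2 x0 y0; rewrite -powRM ?divr_ge0 ?(ltW h1) ?(ltW h2)//.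
have [->|yn] := eqVneq y 0; first by rewrite mul0r invr0 !mulr0.
by congr (_ `^ _); field; rewrite yn !gt_eqF.
Qed.

(** Normalised on [B] and on [U], the likelihood gives two probability weights; the current odds
    factor out, and [bayes_odds_step] bounds the remaining moment by 1. *)
Lemma next_odds_le Ds Ys t d :
  (\int[nu]_y (ps y * next_odds Ds Ys t d y)%:E <= (odds Ds Ys t d)%:E)%E.
Proof.
have margR V : measurable V -> 0 <= fine (marg V Ds Ys t d).
  by move=> mV; rewrite fine_ge0// marg_ge0.
(* If one of the two masses is 0, the corresponding predictive mass is 0 too, and since [x / 0 = 0]
   the next odds vanish in either case. *)
have zero : (forall y, next_odds Ds Ys t d y = 0) ->
    (\int[nu]_y (ps y * next_odds Ds Ys t d y)%:E <= (odds Ds Ys t d)%:E)%E.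
  move=> h; rewrite integral0_eq ?lee_fin ?powR_ge0// => y _.
  by rewrite h mulr0.
have l0' : l != 0 by rewrite gt_eqF.
have [NB0|NBn] := eqVneq (fine (marg B Ds Ys t d)) 0.
  by apply: zero => y; rewrite /next_odds predictive_zero// mul0r powR0.
have [NU0|NUn] := eqVneq (fine (marg U Ds Ys t d)) 0.
  apply: zero => y; rewrite /next_odds [X in _ / fine X]predictive_zero//=.
  by rewrite invr0 mulr0 powR0.
set NB := fine (marg B _ _ _ _) in NBn *.
set NU := fine (marg U _ _ _ _) in NUn *.
have NBp : 0 < NB by rewrite lt_def NBn margR.
have NUp : 0 < NU by rewrite lt_def NUn margR.
pose wt (V : set T) (N : R) th := flik Ds Ys t d th * \1_V th / N.
have mwt V N : measurable V -> measurable_fun setT (wt V N).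
  move=> mV; apply: measurable_funM => //; apply: measurable_funM.
    exact: measurable_flik1.
  exact: measurable_indic.
have wt0 V N th : 0 < N -> 0 <= wt V N th.
  by move=> N0; rewrite /wt mulr_ge0 ?invr_ge0 ?(ltW N0)// mulr_ge0 ?flik_ge0// indicE.
have intw V N (g : T -> R) : measurable V -> 0 < N -> measurable_fun setT g -> (forall th, 0 <= g th) ->
   (\int[m1]_th (wt V N th * g th)%:E =
    N^-1%:E * \int[m1]_(th in V) (flik Ds Ys t d th * g th)%:E)%E.
  move=> mV N0 mg g0; rewrite [in RHS]integral_mkcond -ge0_integralZl_EFin//.
  - apply: eq_integral => th _; rewrite epatch_indic/= -!EFinM /wt.
    by congr EFin; ring.
  - by move=> th _; rewrite epatch_indic -EFinM lee_fin mulr_ge0 ?mulr_ge0 ?flik_ge0// indicE.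
  - apply/(measurable_restrictT _ mV); apply/measurable_EFinP.
    by apply: measurable_funTS; apply: measurable_funM => //; exact: measurable_flik1.
  - by rewrite invr_ge0 ltW.
have wt1 V : measurable V -> 0 < fine (marg V Ds Ys t d) ->
   (\int[m1]_th (wt V (fine (marg V Ds Ys t d)) th)%:E = 1)%E.
  move=> mV N0.
  have := intw V _ (cst 1) mV N0 (measurable_cst _) (fun _ => ler01).
  under eq_integral do rewrite mulr1.
  move=> ->; under eq_integral do rewrite mulr1.
  rewrite -/(marg V Ds Ys t d) -[X in (_ * X)%E]fineK ?marg_fin//.
  by rewrite -EFinM mulVf// gt_eqF.
pose q (V : set T) (N : R) y := fine (\int[m1]_(th in V) (flik Ds Ys t d th * f (th, y))%:E)%E / N.
have qE V N y : measurable V -> 0 < N -> ((q V N y)%:E = \int[m1]_th (wt V N th * f (th, y))%:E)%E.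
  move=> mV N0; rewrite intw//; last exact: measurableT_comp mf (pair2_measurable _).
  by rewrite /q mulrC EFinM fineK// predictive_fin.
have wtV V N th : 0 < wt V N th -> V th.
  rewrite /wt indicE; case: (boolP (th \in V)) => [/set_mem //|_].
  by rewrite mulr0 mul0r ltxx.
have pred0 V y : 0 <= fine (\int[m1]_(th in V) (flik Ds Ys t d th * f (th, y))%:E)%E.
  by apply: fine_ge0; apply: integral_ge0 => th _; rewrite lee_fin mulr_ge0 ?flik_ge0.
have := @bayes_odds_step _ _ T Y R m1 nu f mf f0 f1 ps mps ps0 ps1
  (wt B NB) (wt U NU) (q B NB) (q U NU) A pA e n l
  (mwt _ _ mB) (fun th => wt0 _ _ th NBp) (wt1 _ mB NBp) (fun y => qE _ _ y mB NBp)
  (mwt _ _ mU) (fun th => wt0 _ _ th NUp) (wt1 _ mU NUp) (fun y => qE _ _ y mU NUp)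
  mA pAE e0 pAe (fun th h => HA (wtV _ _ _ h)) n0 (fun th h => Hn (wtV _ _ _ h))
  (fun th h => Hkl (wtV _ _ _ h)) lE.
set I := (X in (X <= 1)%E) => I1.
have mq V N : measurable V -> 0 < N -> measurable_fun setT (q V N).
  move=> mV N0; apply/measurable_EFinP.
  rewrite (_ : _ \o _ = fubini_G m1 (fun z : T * Y => (wt V N z.1 * f z)%:E)); last first.
    by apply/funext => y /=; rewrite qE.
  apply: measurable_fun_fubini_tonelli_G.
    apply/measurable_EFinP; apply: measurable_funM => //.
    exact: (measurableT_comp (mwt _ _ mV) measurable_fst).
  by move=> z; rewrite lee_fin mulr_ge0// wt0.
have q0 V N y : 0 < N -> 0 <= q V N y by move=> N0; rewrite /q divr_ge0 ?pred0// ltW.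
have -> : (\int[nu]_y (ps y * next_odds Ds Ys t d y)%:E = (odds Ds Ys t d)%:E * I)%E.
  rewrite /I -ge0_integralZl_EFin//.
  - apply: eq_integral => y _; rewrite -EFinM; congr EFin.
    by rewrite /next_odds [in LHS](ratio_of_weights NBp NUp)// mulrCA.
  - by move=> y _; rewrite lee_fin mulr_ge0 ?powR_ge0.
  - apply/measurable_EFinP; apply: measurable_funM => //.
    apply: measurable_fun_powR; apply: measurable_fun_div.
    + by move=> y; exact: q0.
    + exact: mq.
    + exact: mq.
  - exact: powR_ge0.
rewrite -[leRHS]mule1; apply: lee_wpmul2l => //.
by rewrite lee_fin powR_ge0.
Qed.

(** [G t] stands for the past, [F t] for what is known just before [Ys t] is observed. Where [d] is
    not chosen the odds do not move; where it is chosen, the new observation is integrated out with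
    the history frozen, and [next_odds_le] gives the supermartingale inequality. *)
Lemma ae_bounded_odds dO (Om : measurableType dO) (P : probability Om R)
    (D : nat -> Om -> Des) (Ys : nat -> Om -> Y) (G F : nat -> set (set Om)) d :
  (forall t X, <<s F t >> X -> measurable X) ->
  (forall t, G t `<=` <<s F t >>) -> (forall t, G t `<=` <<s G t.+1 >>) ->
  (forall t s, (s < t)%N -> <<s G t >> (D s @^-1` [set d])) ->
  (forall t, <<s F t >> (D t @^-1` [set d])) ->
  (forall t s, (s < t)%N ->
     measurable_fun setT (Ys s : g_sigma_algebraType (G t) -> Y)) ->
  (forall t, measurable_fun setT (Ys t)) ->
  (forall t X Z, <<s F t >> X -> X `<=` D t @^-1` [set d] -> measurable Z ->
     P (X `&` Ys t @^-1` Z) = P X * \int[nu]_(y in Z) (ps y)%:E)%E ->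
  {ae P, forall w, exists K : R, forall t,
     fine (marg B (D ^~ w) (Ys ^~ w) t d) / fine (marg U (D ^~ w) (Ys ^~ w) t d) <= K}.
Proof.
move=> mF GF GS mD mDF mY mYt obs.
have GsF t : <<s G t >> `<=` <<s F t >>.
  by apply: smallest_sub; [exact: smallest_sigma_algebra|exact: GF].
pose S t w := odds (D ^~ w) (Ys ^~ w) t d.
have S0 t w : 0 <= S t w by exact: powR_ge0.
have mDO t : measurable (D t @^-1` [set d]) by exact: (mF t).
have mS' dW (W : measurableType dW) (D' : nat -> W -> Des) (Y' : nat -> W -> Y) t :
    (forall s, (s < t)%N -> measurable (D' s @^-1` [set d])) ->
    (forall s, (s < t)%N -> measurable_fun setT (Y' s)) ->
    measurable_fun setT (fun w => odds (D' ^~ w) (Y' ^~ w) t d).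
  move=> mD' mY'; apply: measurable_fun_powR; apply: measurable_fun_div.
  - by move=> w; apply: fine_ge0; exact: marg_ge0.
  - by apply: measurableT_comp => //; exact: measurable_marg.
  - by apply: measurableT_comp => //; exact: measurable_marg.
have mS t : measurable_fun setT (S t : g_sigma_algebraType (G t) -> R).
  by apply: mS' => s st; [exact: mD|exact: mY].
have mSO t : measurable_fun setT (S t).
  by apply: mS' => s st; [exact: mDO|exact: mYt].
pose Qm := mdensity nu mps ps0.
have Q1 : Qm setT = 1%E by [].
pose Q : probability Y R := HB.pack Qm (Measure_isProbability.Build _ _ _ Qm Q1).
have supS t X : <<s G t >> X ->
    (\int[P]_(w in X) (S t.+1 w)%:E <= \int[P]_(w in X) (S t w)%:E)%E.
  move=> GX; have FX := GsF t _ GX; have mX := mF t _ FX.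
  pose E := D t @^-1` [set d].
  have FXE : <<s F t >> (X `&` E).
    by apply: (@measurableI _ (g_sigma_algebraType (F t))) => //; exact: mDF.
  have mXE := mF t _ FXE.
  have mXnE : measurable (X `&` ~` E) by apply: measurableI => //; apply: measurableC; exact: mDO.
  have split u : (\int[P]_(w in X) (S u w)%:E =
     \int[P]_(w in X `&` E) (S u w)%:E + \int[P]_(w in X `&` ~` E) (S u w)%:E)%E.
    rewrite -ge0_integral_setU//.
    - by rewrite -setIUr setUv setIT.
    - by apply/measurable_EFinP; exact: measurable_funTS.
    - by move=> w _; rewrite lee_fin.
    - by rewrite disj_set2E; apply/eqP/seteqP; split => w // -[[_ h] [_ h2]].
  rewrite !split; apply: leeD; last first.
    apply: ge0_le_integral => //.
    - by move=> w _; rewrite lee_fin.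
    - by apply/measurable_EFinP; exact: measurable_funTS.
    - by apply/measurable_EFinP; exact: measurable_funTS.
    - move=> w [_ nE]; rewrite lee_fin /S /odds !margS.
      by case: eqP => // h; exfalso; apply: nE.
  pose W : measurableType _ := g_sigma_algebraType (F t).
  pose h (z : W * Y) : \bar R := (next_odds (D ^~ z.1) (Ys ^~ z.1) t d z.2)%:E.
  pose D' s (z : W * Y) := if (s < t)%N then D s z.1 else d.
  pose Y' s (z : W * Y) := if (s < t)%N then Ys s z.1 else z.2.
  have hE z : h z = (odds (D' ^~ z) (Y' ^~ z) t.+1 d)%:E.
    have margD V : marg V (D' ^~ z) (Y' ^~ z) t.+1 d =
        (\int[m1]_(th in V) (flik (D ^~ z.1) (Ys ^~ z.1) t d th * f (th, z.2))%:E)%E.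
      rewrite margS {1}/D' ltnn eqxx; apply: eq_integral => th _.
      rewrite (_ : Y' t z = z.2); last by rewrite /Y' ltnn.
      by congr (_ * _)%:E; apply: eq_flik => s st; rewrite /D' /Y' st.
    by rewrite /h /next_odds /odds !margD.
  have mh : measurable_fun setT h.
    rewrite (_ : h = EFin \o (fun z => odds (D' ^~ z) (Y' ^~ z) t.+1 d)); last first.
      by apply/funext => z; rewrite hE.
    apply/measurable_EFinP; apply: mS' => s st.
      rewrite /D'; have [sst|sst] := boolP (s < t)%N; last first.
        by rewrite (_ : _ @^-1` _ = setT)//; apply/seteqP; split.
      rewrite (_ : _ @^-1` _ = (D s @^-1` [set d] : set W) `*` setT); last first.
        by apply/seteqP; split => z /=; [move=> ->|case].
      by apply: measurableX => //; apply: GsF; exact: mD.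
    rewrite /Y'; have [sst|sst] := boolP (s < t)%N; last exact: measurable_snd.
    have mYW : measurable_fun setT (Ys s : W -> Y).
      by move=> _ Z mZ; apply: GsF; exact: (mY t s sst measurableT Z mZ).
    exact: measurableT_comp mYW measurable_fst.
  have h0 z : (0 <= h z)%E by rewrite lee_fin powR_ge0.
  have obsQ X' Z : <<s F t >> X' -> X' `<=` X `&` E -> measurable Z ->
      P (X' `&` Ys t @^-1` Z) = (P X' * Q Z)%E.
    by move=> FX' sub mZ; apply: obs => // w /sub[].
  have := @integral_independent_observation _ Om R P _ Y Q (F t) (mF t) (Ys t) (X `&` E) h
    (mYt t) FXE obsQ mh h0.
  have -> : (\int[P]_(w in X `&` E) h (w, Ys t w) = \int[P]_(w in X `&` E) (S t.+1 w)%:E)%E.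
    apply: eq_integral => w; rewrite inE => -[_ Ew].
    by rewrite /h /S /odds /next_odds !margS Ew eqxx.
  move=> ->; apply: ge0_le_integral => //.
  - by move=> w _; apply: integral_ge0 => y _; exact: h0.
  - have mF' : measurable_fun (setT : set W) (fubini_F Q h) by exact: measurable_fun_fubini_tonelli_F.
    apply: (@measurable_funTS _ _ Om _ _ (fubini_F Q h : Om -> \bar R)).
    by move=> _ Z mZ; apply: (mF t); exact: (mF' measurableT Z mZ).
  - by apply/measurable_EFinP; exact: measurable_funTS.
  - move=> w _; rewrite ge0_integral_mdensity//.
    + rewrite /h /S; apply: le_trans (next_odds_le _ _ _ _).
      by under eq_integral do rewrite -EFinM mulrC.
    + exact: measurableT_comp mh (pair1_measurable _).
(* At time 0 the likelihood is an empty product, so the process starts from a deterministic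
   value. *)
have S00 : (\int[P]_w (S 0%N w)%:E <= ((fine (m1 B) / fine (m1 U)) `^ l)%:E)%E.
  rewrite (eq_integral (cst ((fine (m1 B) / fine (m1 U)) `^ l)%:E)); last first.
    move=> w _ /=; rewrite /S /odds /marg.
    by under eq_integral do rewrite /flik big_ord0; under [in X in _ / fine X]eq_integral do rewrite /flik big_ord0;
      rewrite !integral_cst// !mul1e.
  rewrite integral_cst//. rewrite -[leRHS]mule1.
  by apply: lee_wpmul2l; [rewrite lee_fin powR_ge0|exact: probability_le1].
have mG t X : <<s G t >> X -> measurable X by move=> /GsF; exact: mF.
have := @supermartingale_ae_bounded _ Om R P G mG GS S S0 mS supS _ S00.
apply: filterS => w [K hK]; exists (K `^ l^-1) => t.
have r0 : 0 <= fine (marg B (D ^~ w) (Ys ^~ w) t d) / fine (marg U (D ^~ w) (Ys ^~ w) t d).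
  by apply: divr_ge0; apply: fine_ge0; exact: marg_ge0.
have := hK t; rewrite /S /odds; set r := _ / _ in r0 * => rK.
have -> : r = (r `^ l) `^ l^-1 by rewrite -powRrM divff ?powRr1// gt_eqF.
apply: ge0_ler_powR => //; rewrite ?nnegrE ?powR_ge0 ?invr_ge0 ?(ltW l0)//.
exact: le_trans (powR_ge0 _ _) rK.
Qed.

End odds.
End likelihood.

(** * Densities over a compact set of parameters *)

Section universal_integrability.
Context d (Y : measurableType d) (R : realType).

(** Converts the integrability clause of [universal_GC], valid under every law, into a uniform bound
    on each log-likelihood ratio. *)
Lemma universally_integrable_bounded (f : Y -> R) : measurable_fun setT f ->
  (forall Q : probability Y R, Q.-integrable setT (EFin \o f)) ->
  exists2 M : R, 0 <= M & forall y, `|f y| <= M.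
Proof.
move=> mf intf; apply: contrapT => /forall2NP nb.
(* The law with mass [2 ^ - n.+1] at points where [2 ^ n.+1 < `|f|] integrates [`|f|] to [+oo]. *)
have pick_y n : exists y, (2 ^ n.+1)%:R < `|f y|.
  apply: contrapT => /forallNP h; have [//|] := nb (2 ^ n.+1)%:R.
  by apply=> y; rewrite leNgt; apply/negP; exact: h.
have [ys hys] := choice pick_y.
pose w n : {nonneg R} := NngNum (divr_ge0 (@ler01 R) (ler0n R (2 ^ n.+1))).
pose mu_ n : {measure set Y -> \bar R} := mscale (w n) (@dirac _ Y (ys n) R).
pose mu := mseries mu_ 0.
have mu1 : mu setT = 1%E.
  have cv := @cvg_geometric_series_half R 1 0.
  rewrite expr0 divr1 in cv.
  rewrite /mu /= /mseries; apply/cvg_lim => //.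
  rewrite (_ : (fun n => _) = EFin \o series (fun k => 1 / (2 ^ (k + 1))%:R : R)).
    by apply: cvg_EFin; [exact: nearW|exact: cv].
  apply/funext => n; rewrite /series /= -sumEFin; apply: eq_bigr => i _.
  by rewrite /mscale /= diracT mule1 addn1.
pose Q : probability Y R := HB.pack mu (Measure_isProbability.Build _ _ _ mu mu1).
have /integrableP[_] := intf Q.
have mabs : measurable_fun setT (fun y => `|f y|%:E).
  by apply/measurable_EFinP; exact: measurableT_comp.
have -> : (\int[Q]_y `|(EFin \o f) y| = \int[mseries mu_ 0]_y (`|f y|%:E))%E by [].
rewrite ge0_integral_measure_series//.
rewrite ltNge => /negP; apply; rewrite leye_eq; apply/eqP/eqyP => r r0.
have hint n : (1 <= \int[mu_ n]_y (`|f y|%:E))%E.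
  rewrite ge0_integral_mscale// integral_dirac//= diracT mul1e -EFinM lee_fin.
  by rewrite mul1r -ler_pdivrMl ?invr_gt0 ?ltr0n ?expn_gt0// invrK mulr1 ltW.
have [n rn] : exists n : nat, r < n%:R.
  by exists (Num.bound r); apply: archi_boundP; exact: ltW.
apply: (@le_trans _ _ n%:R%:E); first by rewrite lee_fin ltW.
apply: le_trans (nneseries_lim_ge (P := xpredT) (m := 0) n _); last first.
  by move=> i _ _; apply: integral_ge0 => y _; rewrite lee_fin.
apply: (@le_trans _ _ (\sum_(0 <= i < n) 1)%E).
  by rewrite sumEFin lee_fin sumr_const_nat subn0.
by apply: lee_sum.
Qed.

End universal_integrability.

Section row_space.
Context {R : realType} {k : nat}.
Local Notation V := 'rV[R]_k.+1.
Local Notation T := (Borel_rV R k.+1).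
Implicit Types (Th : set V) (x : V).

Lemma open_measurable_rV (A : set V) : open A -> measurable (A : set T).
Proof. exact: sub_sigma_algebra. Qed.

Lemma closed_measurable_rV (A : set V) : closed A -> measurable (A : set T).
Proof.
move=> cA; rewrite -[A]setCK; apply: measurableC.
by apply: open_measurable_rV; exact: closed_openC.
Qed.

Lemma compact_measurable_rV (A : set V) : compact A -> measurable (A : set T).
Proof.
by move=> cA; apply: closed_measurable_rV; apply: compact_closed => //; exact: norm_hausdorff.
Qed.

Lemma within_continuous_ball Th (g : V -> R) x e :
  {within Th, continuous g} -> Th x -> 0 < e ->
  exists2 r, 0 < r & forall x', Th x' -> ball x r x' -> `|g x - g x'| < e.
Proof.
move=> /subspace_continuousP/(_ x) cg Tx e0.
have /cvgrPdist_lt/(_ e e0) := cg Tx.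
rewrite nearE /within /= => /nbhs_ballP[r /= r0 h].
by exists r => // x' Tx' b; exact: (h x' b Tx').
Qed.

Lemma compact_ball_net Th r : compact Th -> 0 < r ->
  exists s : seq V, (forall c, c \in s -> Th c) /\
    forall x, Th x -> exists2 c, c \in s & ball c r x.
Proof.
rewrite compact_cover => cT r0.
have [i _|x Tx|D sub cov] := cT _ Th (fun c : V => ball c r).
- exact: ball_open.
- by exists x => //; exact: ballxx.
exists (finmap.enum_fset D); split => [c /sub|x /cov]; first by move/set_mem.
by case=> c /= cD b; exists c.
Qed.

Lemma compact_bounded_above Th (g : V -> R) : compact Th ->
  {within Th, continuous g} -> exists K, forall x, Th x -> g x <= K.
Proof.
move=> cT cg; have := continuous_compact cg cT => /compact_bounded[K [_ hK]].
exists (K + 1) => x Tx; apply: le_trans (ler_norm _) _.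
by apply: (hK (K + 1)); [rewrite ltrDl|exists x].
Qed.

(* Parameters outside [Th] are sent to [x0] so that the hypotheses on the densities
   hold for every parameter, without a measurability condition on [p] off [Th]. *)
Definition retract Th x0 x := if x \in Th then x else x0.

Lemma retract_in Th x0 x : Th x0 -> Th (retract Th x0 x).
Proof. by rewrite /retract; case: ifPn => // /set_mem. Qed.

(** A rounding of [x] to a net [s] that takes finitely many values, each on a Borel set. *)
Fixpoint first_center x0 (s : seq V) r x : V :=
  if s is c :: s' then (if x \in (ball c r : set V) then c else first_center x0 s' r x) else x0.

Lemma first_center_ball x0 s r x : (exists2 c, c \in s & ball c r x) ->
  first_center x0 s r x \in s /\ ball (first_center x0 s r x) r x.
Proof.
elim: s => [|c s ih] [c' //=]; rewrite inE; case: ifPn => [/set_mem b _ _|nb].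
  by rewrite inE eqxx.
move=> /predU1P[->|c's] b; first by rewrite mem_set in nb.
by have [i1 i2] := ih (ex_intro2 _ _ c' c's b); rewrite inE i1 orbT.
Qed.

(** Continuity in the parameter and measurability in [y] give joint measurability: with the
    parameter rounded to a finite net of radius [n.+1%:R^-1], the density is a finite case split,
    and it converges pointwise. The net points lie in [Th], where continuity is available. *)
Lemma measurable_retracted_density d (Y : measurableType d) (p : V -> Y -> R) Th x0 :
  compact Th -> Th x0 -> (forall y, {within Th, continuous (fun x => p x y)}) ->
  (forall x, Th x -> measurable_fun setT (p x)) ->
  measurable_fun setT (fun z : T * Y => p (retract Th x0 z.1) z.2).
Proof.
move=> cT T0 cp mp.
have r_gt0 n : 0 < n.+1%:R^-1 :> R by rewrite invr_gt0 ltr0Sn.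
have [s hs] := choice (fun n => compact_ball_net cT (r_gt0 n)).
have mT := compact_measurable_rV cT.
pose g n (z : T * Y) := p (if z.1 \in Th then first_center x0 (s n) n.+1%:R^-1 z.1 else x0) z.2.
have mfst (A : set T) : measurable A -> measurable_fun setT (fun z : T * Y => z.1 \in A).
  by move=> mA; exact: (measurableT_comp (measurable_mem mA) measurable_fst).
have mc c : Th c -> measurable_fun setT (fun z : T * Y => p c z.2).
  by move=> Tc; exact: (measurableT_comp (mp c Tc) measurable_snd).
have mg n : measurable_fun setT (g n).
  rewrite (_ : g n = fun z => if z.1 \in Th then p (first_center x0 (s n) n.+1%:R^-1 z.1) z.2 else p x0 z.2).
    apply: measurable_fun_ifT; [exact: mfst| |exact: mc].
    have [hT _] := hs n; elim: (s n) hT => [|c s' ih] hT /=; first exact: mc.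
    rewrite (_ : (fun z : T * Y => _) = fun z => if z.1 \in (ball c n.+1%:R^-1 : set V) then p c z.2
        else p (first_center x0 s' n.+1%:R^-1 z.1) z.2); last first.
      by apply/funext => z /=; case: ifP.
    apply: measurable_fun_ifT.
    - by apply: mfst; apply: open_measurable_rV; exact: ball_open.
    - by apply: mc; apply: hT; rewrite mem_head.
    - by apply: ih => c' c's; apply: hT; rewrite inE c's orbT.
  by apply/funext => z; rewrite /g; case: ifP.
apply: (measurable_fun_cvg (h := g)) => // z _.
rewrite /g /retract; case: ifPn => [/set_mem Tz|_]; last exact: cvg_cst.
apply/cvgrPdist_lt => e e0.
have [r r0 h] := within_continuous_ball (cp z.2) Tz e0.
near=> n.
have [hT hb] := hs n.
have [cin cb] := first_center_ball x0 (hb _ Tz).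
apply: h; first exact: hT.
apply: ball_sym; apply: le_ball cb; apply: ltW.
by near: n; exact: near_infty_natSinv_lt (PosNum r0).
Unshelve. all: by end_near.
Qed.

(** Fatou's lemma along a sequence of parameters that converges to [x0] and violates the claim. *)
Lemma mass_lower_semicontinuous d (Y : measurableType d)
    (nu : {measure set Y -> \bar R}) (p : V -> Y -> R) Th x0 (A : set Y) (c : R) :
  Th x0 -> (forall y, {within Th, continuous (fun x => p x y)}) ->
  (forall x, Th x -> measurable_fun setT (p x) /\ forall y, 0 <= p x y) ->
  measurable A -> (c%:E < \int[nu]_(y in A) (p x0 y)%:E)%E ->
  exists2 r, 0 < r & forall x, Th x -> ball x0 r x ->
    (c%:E < \int[nu]_(y in A) (p x y)%:E)%E.
Proof.
move=> T0 cp mp mA cA; apply: contrapT => /forall2NP nb.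
have bad n : exists x, [/\ Th x, ball x0 n.+1%:R^-1 x & (\int[nu]_(y in A) (p x y)%:E <= c%:E)%E].
  have [|h] := nb n.+1%:R^-1; first by rewrite invr_gt0 ltr0Sn.
  apply: contrapT => /forallNP h2; apply: h => x Tx b.
  by rewrite ltNge; apply/negP => le; apply: (h2 x).
have [xs hxs] := choice bad.
suff : (\int[nu]_(y in A) (p x0 y)%:E <= c%:E)%E by rewrite leNgt cA.
have lim y : (p (xs n) y)%:E @[n --> \oo] --> (p x0 y)%:E.
  apply: cvg_EFin; first exact: nearW.
  apply/cvgrPdist_lt => e e0.
  have [r r0 h] := within_continuous_ball (cp y) T0 e0.
  near=> n; have [Tn bn _] := hxs n; apply: h => //.
  apply: le_ball bn; apply: ltW.
  by near: n; exact: near_infty_natSinv_lt (PosNum r0).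
rewrite (eq_integral (fun y => limn_einf (fun n => (p (xs n) y)%:E))); last first.
  by move=> y _; rewrite (cvg_limn_einf_sup (lim y)).1.
apply: le_trans (fatou nu mA _ _) _.
- by move=> n; apply/measurable_EFinP/measurable_funTS; have [Tn _ _] := hxs n; exact: (mp _ Tn).1.
- by move=> n y _; have [Tn _ _] := hxs n; rewrite lee_fin; exact: (mp _ Tn).2.
rewrite limn_einf_lim; apply: lime_le; first exact: is_cvg_einfs.
apply: nearW => n; apply: le_trans (_ : _ <= \int[nu]_(y in A) (p (xs n) y)%:E)%E _.
  by apply: ereal_inf_lbound; exists n => /=.
by have [_ _] := hxs n.
Unshelve. all: by end_near.
Qed.

Section lebesgue.
Variable lam : {measure set T -> \bar R}.
Hypothesis Hlam : is_lebesgue_rV lam.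

Lemma closed_box (a b : V) : closed [set x : V | forall i, a 0 i <= x 0 i <= b 0 i].
Proof.
rewrite (_ : [set x | _] = \bigcap_(i in setT) ((fun x : V => x 0 i) @^-1` `[a 0 i, b 0 i])).
  apply: closed_bigI => i _; apply: closed_comp; last exact: interval_closed.
  by move=> x _; exact: coord_continuous.
apply/seteqP; split => x /= h i; first by move=> _; rewrite /= in_itv/=.
by have := h i I; rewrite /= in_itv.
Qed.

(** Balls of rows are taken coordinatewise, so the ball contains the box of half-width [r / 2]. *)
Lemma lebesgue_ball_gt0 x r : 0 < r -> (0 < lam (ball x r : set T))%E.
Proof.
move=> r0; pose h : V := const_mx (r / 2).
pose box : set T := [set y : V | forall i, (x - h) 0 i <= y 0 i <= (x + h) 0 i].
have mbox : measurable box by apply: closed_measurable_rV; exact: closed_box.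
apply: (@lt_le_trans _ _ (lam box)).
  rewrite /box Hlam => [|i]; last by rewrite !mxE; lra.
  rewrite lte_fin; apply: prodr_gt0 => i _; rewrite !mxE; lra.
apply: le_measure; rewrite ?inE//; first by apply: open_measurable_rV; exact: ball_open.
move=> y yb; rewrite /ball/=; split=> // i j; rewrite ord1 /ball/= ltr_distlC.
have := yb j; rewrite !mxE => /andP[h1 h2]; apply/andP; split; lra.
Qed.

Lemma lebesgue_compact_fin Th : compact Th -> (lam (Th : set T) < +oo)%E.
Proof.
move=> cT.
have bd (i : 'I_k.+1) : exists K, forall x, Th x -> `|x 0 i| <= K.
  apply: (compact_bounded_above (g := fun x => `|x 0 i|) cT).
  apply: continuous_subspaceT => x; apply: continuous_comp; first exact: coord_continuous.
  exact: norm_continuous.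
have [K hK] := choice bd.
pose b : V := \row_i Num.max (K i) 0.
pose box : set T := [set y : V | forall i, (- b) 0 i <= y 0 i <= b 0 i].
have mbox : measurable box by apply: closed_measurable_rV; exact: closed_box.
apply: (@le_lt_trans _ _ (lam box)).
  apply: le_measure; rewrite ?inE//; first exact: compact_measurable_rV.
  move=> y Ty i; rewrite !mxE -ler_norml; apply: le_trans (hK i y Ty) _.
  by rewrite le_max lexx.
rewrite /box Hlam ?ltry// => i; rewrite !mxE.
have : 0 <= Num.max (K i) 0 by rewrite le_max lexx orbT.
by lra.
Qed.

End lebesgue.
End row_space.

(** * The posterior keeps mass near the truth *)

Section posterior.
Context {R : realType} {k : nat} (Des : finType).
Local Notation V := 'rV[R]_k.+1.
Local Notation T := (Borel_rV R k.+1).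
Variables (lam : {measure set T -> \bar R}) (Th : set V) (x0 : V).
Hypotheses (Hlam : is_lebesgue_rV lam) (cTh : compact Th) (Th0 : Th x0).
Context dY (Y : measurableType dY) (p : V -> Y -> R).
Hypotheses (p0 : forall th, Th th -> forall y, 0 <= p th y)
  (mp : forall th, Th th -> measurable_fun setT (p th))
  (cp : forall y, {within Th, continuous (fun th => p th y)}).

Let mTh : measurable (Th : set T). Proof. exact: compact_measurable_rV. Qed.

Definition prior_weight : T -> R := \1_Th.

Let mw : measurable_fun setT prior_weight.
Proof. by apply: measurable_indic. Qed.

Let w0 x : 0 <= prior_weight x. Proof. by rewrite /prior_weight indicE. Qed.

Let prior_measure := mdensity lam mw w0.

Let prior_measureE B : measurable B -> prior_measure B = lam (Th `&` B).
Proof. by move=> mB; rewrite /prior_measure /mdensity integral_indic. Qed.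

Let prior_measure_fin : fin_num_fun prior_measure.
Proof.
move=> B mB; rewrite prior_measureE// ge0_fin_numE//.
apply: le_lt_trans (lebesgue_compact_fin Hlam cTh).
by apply: le_measure; rewrite ?inE//; exact: measurableI.
Qed.

(** Lebesgue measure restricted to [Th], left unnormalised because a posterior is a quotient of
    masses. *)
Definition prior : {finite_measure set T -> \bar R} :=
  HB.pack (mdensity lam mw w0)
    (Measure_isFinite.Build _ _ _ (mdensity lam mw w0) prior_measure_fin).

Lemma priorE B : measurable B -> prior B = lam (Th `&` B).
Proof. exact: prior_measureE. Qed.

Definition rdensity (z : T * Y) : R := p (retract Th x0 z.1) z.2.
Local Notation f := rdensity.

Lemma measurable_rdensity : measurable_fun setT f.
Proof. exact: measurable_retracted_density. Qed.

Lemma rdensity_ge0 z : 0 <= f z.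
Proof. by apply: p0; exact: retract_in. Qed.

Lemma rdensity_bounded y : exists K : R, forall th, f (th, y) <= K.
Proof.
have [K hK] := compact_bounded_above cTh (@cp y).
by exists K => th; apply: hK; exact: retract_in.
Qed.

Lemma rdensityE th y : Th th -> f (th, y) = p th y.
Proof. by move=> h; rewrite /f /retract mem_set. Qed.

Lemma ge0_integral_prior B (g : T -> R) : measurable B -> measurable_fun setT g ->
  (forall th, 0 <= g th) ->
  (\int[prior]_(th in B) (g th)%:E = \int[lam]_(th in B `&` Th) (g th)%:E)%E.
Proof.
move=> mB mg g0; rewrite [LHS]integral_mkcond ge0_integral_mdensity//.
- rewrite [RHS]integral_mkcond; congr (integral _ _ _); apply/funext => th.
  by rewrite !epatch_indic/= indicI EFinM muleA.
- by apply/(measurable_restrictT _ mB)/measurable_EFinP/measurable_funTS.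
- by move=> th; rewrite epatch_indic mule_ge0 ?lee_fin.
Qed.

Local Notation marg := (marg prior f).

Let mfl Ds Ys t (d : Des) : measurable_fun setT (flik f Ds Ys t d).
Proof. by apply: measurable_flik1; exact: measurable_rdensity. Qed.

Let fl0 Ds Ys t (d : Des) th : 0 <= flik f Ds Ys t d th.
Proof. by apply: flik_ge0; exact: rdensity_ge0. Qed.

Lemma postE Ds Ys t (d : Des) B : measurable (B : set T) ->
  post lam Th p Ds Ys t d B = fine (marg B Ds Ys t d) / fine (marg setT Ds Ys t d).
Proof.
move=> mB; rewrite /post /Defs.post.
have E (C : set T) : C `<=` Th ->
    (\int[lam]_(x in C) (lik p Ds Ys t d x)%:E = \int[lam]_(x in C) (flik f Ds Ys t d x)%:E)%E.
  move=> CT; apply: eq_integral => x; rewrite inE => Cx; congr EFin.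
  by apply: eq_bigr => s _; rewrite rdensityE//; exact: CT.
rewrite !E//.
have mE (C : set T) : measurable C -> marg C Ds Ys t d =
    (\int[lam]_(x in C `&` Th) (flik f Ds Ys t d x)%:E)%E.
  by move=> mC; exact: ge0_integral_prior.
by rewrite !mE// setTI.
Qed.

Let mfin B Ds Ys t (d : Des) : measurable B -> marg B Ds Ys t d \is a fin_num.
Proof.
by move=> mB; apply: marg_fin => //; [exact: measurable_rdensity|exact: rdensity_ge0|exact: rdensity_bounded].
Qed.

Let mge0 B Ds Ys t (d : Des) : 0 <= fine (marg B Ds Ys t d).
Proof. by apply: fine_ge0; apply: marg_ge0; exact: rdensity_ge0. Qed.

Lemma marg_subadd A B C Ds Ys t (d : Des) : measurable A -> measurable B -> measurable C ->
  A `<=` B `|` C ->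
  fine (marg A Ds Ys t d) <= fine (marg B Ds Ys t d) + fine (marg C Ds Ys t d).
Proof.
move=> mA mB mC sub; rewrite -fineD ?mfin//; apply: fine_le.
- exact: mfin.
- by rewrite fin_numD !mfin.
have mE X : measurable_fun X (fun x => (flik f Ds Ys t d x)%:E).
  by apply/measurable_EFinP; exact: measurable_funTS.
have g0 X x : X x -> (0 <= (flik f Ds Ys t d x)%:E)%E by move=> _; rewrite lee_fin.
apply: (@le_trans _ _ (marg (B `|` (C `\` B)) Ds Ys t d)).
  apply: ge0_subset_integral => //.
  - by apply: measurableU => //; exact: measurableD.
  - exact: g0.
  - by move=> x Ax; case: (pselect (B x)) => nB; [left|right; case: (sub x Ax)].
rewrite /marg ge0_integral_setU//; last 3 first.
- exact: measurableD.
- exact: g0.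
- by rewrite disj_set2E; apply/eqP/seteqP; split => x // -[? []].
apply: leeD2l; apply: ge0_subset_integral => //.
- exact: measurableD.
- exact: g0.
Qed.

(** The likelihood is a finite product, so it vanishes only on a finite union of null sets. *)
Lemma marg_gt0 B Ds Ys t (d : Des) : measurable B -> (0 < prior B)%E ->
  (forall s, (s < t)%N -> Ds s = d -> prior [set th | f (th, Ys s) == 0] = 0%E) ->
  0 < fine (marg B Ds Ys t d).
Proof.
move=> mB B0 null; rewrite lt_def mge0 andbT fine_eq0 ?mfin//; apply/eqP => m0.
have mf2 y : measurable_fun setT (fun th => f (th, y)).
  exact: measurableT_comp measurable_rdensity (pair2_measurable y).
have mE : measurable_fun B (fun th => (flik f Ds Ys t d th)%:E).
  by apply/measurable_EFinP; exact: measurable_funTS.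
have : (\int[prior]_(th in B) `|(flik f Ds Ys t d th)%:E| = 0)%E.
  by rewrite -[RHS]m0; apply: eq_integral => th _; rewrite gee0_abs// lee_fin.
move=> /(ae_eq_integral_abs prior mB mE) h.
pose N s := if Ds s == d then [set th | f (th, Ys s) == 0] else set0.
have mN s : measurable (N s).
  rewrite /N; case: ifP => // _; apply: measurable_pred.
  by apply: measurable_fun_eqr => //.
have nN s : (s < t)%N -> prior.-negligible (N s).
  move=> st; exists (N s); split => //.
  by rewrite /N; case: eqP => [|_]; [exact: null|rewrite measure0].
have nU : prior.-negligible (\big[setU/set0]_(s < t) N s).
  rewrite -(big_mkord xpredT N) big_nat_cond.
  by apply: negligible_bigsetU => s /andP[/andP[_ st] _]; exact: nN.
have : prior.-negligible B.
  apply: negligibleS (negligibleU h nU) => th Bth.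
  have [Ut|nUt] := pselect ((\big[setU/set0]_(s < t) N s) th); [by right|left => /= hh].
  apply: nUt; have [/eqP] := hh Bth; rewrite prodf_seq_eq0 => /hasP[/= s _ /andP[/eqP Ds_d fs0]].
  rewrite -(bigcup_mkord t N); exists s => //=.
  by rewrite /N Ds_d eqxx /=.
by move=> /(measure_negligible mB) B00; rewrite B00 ltxx in B0.
Qed.

Lemma marg_mono A B Ds Ys t (d : Des) : measurable A -> measurable B ->
  A `<=` B -> fine (marg A Ds Ys t d) <= fine (marg B Ds Ys t d).
Proof.
move=> mA mB AB; have := @marg_subadd A B set0 Ds Ys t d mA mB measurable0.
by rewrite setU0 {3}/marg integral_set0 /= addr0; exact.
Qed.

Lemma measurable_post dW (W : measurableType dW) (D : nat -> W -> Des)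
    (Yw : nat -> W -> Y) t d (B : set T) : measurable B ->
  (forall s, (s < t)%N -> measurable (D s @^-1` [set d])) ->
  (forall s, (s < t)%N -> measurable_fun setT (Yw s)) ->
  measurable_fun setT (fun w => post lam Th p (D ^~ w) (Yw ^~ w) t d B).
Proof.
move=> mB mD mY; under eq_fun do rewrite postE//.
apply: measurable_fun_div => //; apply: measurableT_comp => //;
  apply: measurable_marg => //; [exact: measurable_rdensity|exact: rdensity_ge0|
  exact: measurable_rdensity|exact: rdensity_ge0].
Qed.

Lemma post_ge0 Ds Ys t (d : Des) (B : set T) : measurable B ->
  0 <= post lam Th p Ds Ys t d B.
Proof. by move=> mB; rewrite postE//; apply: divr_ge0. Qed.

Local Opaque prior.

Section consistency.
Variable nu : {measure set Y -> \bar R}.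
Hypothesis Hnu : sigma_finite setT nu.
Hypothesis p1 : forall th, Th th -> (\int[nu]_y (p th y)%:E = 1)%E.
Variable ts : V.
Hypothesis ts_int : interior Th ts.
Hypothesis ident : forall th, Th th -> th <> ts -> exists B : set Y, measurable B /\
  (\int[nu]_(y in B) (p th y)%:E)%E <> (\int[nu]_(y in B) (p ts y)%:E)%E.
Hypothesis llr_bounded : forall th, Th th ->
  exists2 M : R, 0 <= M & forall y, `|ln (p ts y / p th y)| <= M.
Hypothesis KLfin : forall th, Th th -> KL nu p ts th \is a fin_num.
Hypothesis KLcont : {for ts, continuous (fun th => fine (KL nu p ts th))}.

Let nu' : {sigma_finite_measure set Y -> \bar R} :=
  sigma_finite_measure_of Hnu.

Let Ts : Th ts. Proof. exact: interior_subset. Qed.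
Let mps : measurable_fun setT (p ts). Proof. exact: mp. Qed.
Let ps0 y : 0 <= p ts y. Proof. exact: p0. Qed.

Lemma KL_integral th : Th th -> nu [set y | 0 < p ts y /\ p th y = 0] = 0%E /\
  KL nu p ts th = (\int[nu]_y (p ts y * ln (p ts y / p th y))%:E)%E.
Proof. by move=> /KLfin; rewrite /KL; case: pselect. Qed.

Lemma KL_self : fine (KL nu p ts ts) = 0.
Proof.
rewrite (KL_integral Ts).2 integral0_eq// => y _.
by have [->|n0] := eqVneq (p ts y) 0; rewrite ?mul0r// divff// ln1 mulr0.
Qed.

Let mass th (A : set Y) : Th th -> measurable A ->
  exists2 a : R, (\int[nu]_(y in A) (p th y)%:E = a%:E)%E & a <= 1.
Proof.
move=> Tt mA; have le1 : (\int[nu]_(y in A) (p th y)%:E <= 1)%E.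
  rewrite -(p1 Tt); apply: ge0_subset_integral => //.
  - by apply/measurable_EFinP; exact: mp.
  - by move=> y _; rewrite lee_fin p0.
have ge0 : (0 <= \int[nu]_(y in A) (p th y)%:E)%E.
  by apply: integral_ge0 => y _; rewrite lee_fin p0.
exists (fine (\int[nu]_(y in A) (p th y)%:E)).
  by rewrite fineK// ge0_fin_numE//; apply: le_lt_trans le1 _; rewrite ltry.
rewrite -lee_fin fineK// ge0_fin_numE//; apply: le_lt_trans le1 _; exact: ltry.
Qed.

Let massC th (A : set Y) : Th th -> measurable A ->
  (\int[nu]_(y in A) (p th y)%:E + \int[nu]_(y in ~` A) (p th y)%:E = 1)%E.
Proof.
move=> Tt mA; rewrite -ge0_integral_setU//.
- by rewrite setUv p1.
- exact: measurableC.
- by apply/measurable_EFinP; apply: measurable_funTS; exact: mp.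
- by move=> y _; rewrite lee_fin p0.
- by rewrite disj_set2E setICr.
Qed.

(** Identifiability only says that two masses differ; passing to the complement if necessary gives
    the wanted sign. *)
Lemma separating_set th : Th th -> th <> ts -> exists A pA b, [/\ measurable A,
  (\int[nu]_(y in A) (p ts y)%:E = pA%:E)%E,
  (\int[nu]_(y in A) (p th y)%:E = b%:E)%E, pA < b & b <= 1].
Proof.
move=> Tt ne; have [A [mA nA]] := ident Tt ne.
have mCA : measurable (~` A) by exact: measurableC.
have [a ha a1] := mass Ts mA; have [b hb b1] := mass Tt mA.
have [a' ha' a1'] := mass Ts mCA; have [b' hb' b1'] := mass Tt mCA.
have := massC Ts mA; rewrite ha ha' -EFinD => -[ea].
have := massC Tt mA; rewrite hb hb' -EFinD => -[eb].
have nab : a <> b by move=> ab; apply: nA; rewrite ha hb ab.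
have [ab|ba|//] := ltgtP a b; first by exists A, a, b.
by exists (~` A), a', b'; split => //; lra.
Qed.

Let bad n (z : T * Y) := (0 < p ts z.2) &&
  ~~ (expR (- n%:R) * p ts z.2 <= f z <= expR n%:R * p ts z.2).

Let mbad n : measurable [set z | bad n z].
Proof.
have mpz : measurable_fun setT (fun z : T * Y => p ts z.2).
  exact: measurableT_comp mps measurable_snd.
apply: measurable_pred; apply: measurable_and; first exact: measurable_fun_ltr.
apply: measurable_neg; apply: measurable_and; apply: measurable_fun_ler;
  by [exact: measurable_rdensity|apply: measurable_funM].
Qed.

(** Parameters whose log-likelihood ratio with [ts] is at most [n] in absolute value, up to a null
    set. The bound in [llr_bounded] varies with the parameter, hence a countable family. *)
Let good_set (n : nat) : set T := [set th | nu (xsection [set z | bad n z] th) = 0%E].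

Let mgood n : measurable (good_set n).
Proof.
have := measurable_fun_xsection nu' (mbad n).
move=> /(_ measurableT [set 0%E] (emeasurable_set1 _)); rewrite setTI.
by congr measurable; apply/seteqP; split.
Qed.

Let good_cover th : Th th -> exists n, good_set n th.
Proof.
move=> Tt; have [M M0 hM] := llr_bounded Tt.
exists (Num.bound M); rewrite /good_set/=.
have [null _] := KL_integral Tt.
have mX := @measurable_xsection _ _ T Y _ th (mbad (Num.bound M)).
apply/eqP; rewrite eq_le measure_ge0 andbT -null; apply: le_measure; rewrite ?inE//.
  rewrite (_ : [set y | _] = [set y | (0 < p ts y) && (p th y == 0)]).
    apply: measurable_pred; apply: measurable_and; first exact: measurable_fun_ltr.
    by apply: measurable_fun_eqr => //; exact: mp.
  by apply/seteqP; split => y /=; [move=> [-> ->]; rewrite eqxx|move=> /andP[? /eqP]].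
move=> y; rewrite /xsection/= inE/= /bad/= rdensityE// => /andP[py nb]; split => //.
(* Where [p th y = 0], the conventions for division and [ln] at 0 make the ratio bound say nothing;
   such [y] form a null set because the divergence is finite. *)
have [//|fn] := eqVneq (p th y) 0.
have fy : 0 < p th y by rewrite lt_def fn p0.
exfalso; move/negP: nb; apply.
have Mb : M <= (Num.bound M)%:R by apply: ltW; exact: archi_boundP.
have := le_trans (hM y) Mb; rewrite ln_div ?posrE// ler_norml => /andP[h1 h2].
by apply/andP; split; rewrite -ler_ln ?posrE ?mulr_gt0 ?expR_gt0// lnM ?posrE ?expR_gt0// expRK; lra.
Qed.

Lemma prior_nbhs_gt0 x (U : set T) : measurable U -> nbhs (x : V) (U : set V) ->
  interior Th x -> (0 < prior U)%E.
Proof.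
move=> mU Ux Tx; have : nbhs x ((U : set V) `&` Th) by exact: filterI.
move=> /nbhs_ballP[r r0 h]; rewrite priorE//.
apply: lt_le_trans (lebesgue_ball_gt0 Hlam x r0) _.
apply: le_measure; rewrite ?inE//.
- by apply: open_measurable_rV; exact: ball_open.
- exact: measurableI.
- by move=> y /h[]; split.
Qed.

Context dO (Om : measurableType dO) (P : probability Om R).
Variables (D : nat -> Om -> Des) (Ys : nat -> Om -> Y) (G F : nat -> set (set Om)).
Variable d : Des.
Hypotheses (mF : forall t X, <<s F t >> X -> measurable X)
  (GF : forall t, G t `<=` <<s F t >>) (GS : forall t, G t `<=` <<s G t.+1 >>)
  (mD : forall t s, (s < t)%N -> <<s G t >> (D s @^-1` [set d]))
  (mDF : forall t, <<s F t >> (D t @^-1` [set d]))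
  (mY : forall t s, (s < t)%N ->
     measurable_fun setT (Ys s : g_sigma_algebraType (G t) -> Y))
  (mYt : forall t, measurable_fun setT (Ys t))
  (obs : forall t X Z, <<s F t >> X -> X `<=` D t @^-1` [set d] -> measurable Z ->
     P (X `&` Ys t @^-1` Z) = (P X * \int[nu]_(y in Z) (p ts y)%:E)%E).

(** Finite divergence forbids, for each parameter, a zero density where [p ts] is positive, up to a
    null set. Tonelli exchanges the quantifiers, and an observation of [d], having density [p ts],
    almost surely avoids the exceptional set [N]. *)
Lemma ae_likelihood_pos : {ae P, forall w, forall s, D s w = d ->
  prior [set th | f (th, Ys s w) == 0] = 0%E}.
Proof.
pose Z := [set z : T * Y | (0 < p ts z.2) && (f z == 0)].
have mZ : measurable Z.
  apply: measurable_pred; apply: measurable_and.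
    by apply: measurable_fun_ltr => //; exact: measurableT_comp mps measurable_snd.
  by apply: measurable_fun_eqr => //; exact: measurable_rdensity.
have Z0 th : nu' (xsection Z th) = 0%E.
  have [null _] := KL_integral (retract_in th Th0).
  rewrite -null; congr (nu _); apply/seteqP; split => y; rewrite /xsection/= inE/= /Z/=.
    by move=> /andP[? /eqP].
  by move=> [-> h]; rewrite /f /= h eqxx.
have aeZ := @ae_ysection_null _ _ T Y R prior nu' Z mZ Z0.
pose N : set Y := [set y | ~~ ((0 < p ts y) && (prior (ysection Z y) == 0%E))].
have mpri : measurable_fun setT (fun y => prior (ysection Z y)) by exact: measurable_fun_ysection.
have mN : measurable N.
  apply: measurable_pred; apply: measurable_neg; apply: measurable_and.
    exact: measurable_fun_ltr.
  apply: (measurable_fun_bool true); rewrite setTI.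
  have := mpri measurableT [set 0%E] (emeasurable_set1 _); rewrite setTI.
  by congr measurable; apply/seteqP; split => y /= /eqP.
have intN : (\int[nu]_(y in N) (p ts y)%:E = 0)%E.
  rewrite (@ae_eq_integral _ _ _ nu' N (cst 0%E))//.
  - by rewrite integral0.
  - by apply/measurable_EFinP; exact: measurable_funTS.
  - apply: filterS aeZ => y Zy; rewrite /N /= Zy eqxx andbT -leNgt => py.
    by congr EFin; apply/le_anti; rewrite py ps0.
pose bads s := D s @^-1` [set d] `&` Ys s @^-1` N.
have nb s : P.-negligible (bads s).
  exists (bads s); split => //.
    apply: measurableI; first by apply: (@mF s); exact: mDF.
    by rewrite -[X in measurable X]setTI; exact: mYt.
  rewrite /bads (@obs s _ N (@mDF s))//.
  by rewrite [X in (_ * X)%E]intN mule0.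
apply: negligibleS (negligible_bigcup nb) => w /= /existsNP[s /not_implyP[Dsd np]].
exists s => //; split => //=; rewrite /N /=; apply/negP => /andP[py /eqP h].
apply: np; rewrite -[RHS]h; congr (prior _); apply/seteqP; split => th; rewrite /ysection/= inE/= /Z/= py//.
Qed.

(** A product instead of a quotient, so that the bounds for several [C] add up. *)
Let Bd (C : set T) (U : set T) := {ae P, forall w, exists K : R, forall t,
  fine (marg C (D ^~ w) (Ys ^~ w) t d) <= K * fine (marg U (D ^~ w) (Ys ^~ w) t d)}.

Lemma local_odds_bounded (U : set V) th : open U -> U ts -> Th th -> th <> ts ->
  exists2 r, 0 < r & Bd ((ball th r : set T) `&` Th) U.
Proof.
move=> oU Uts Tt ne.
have [A [pA [b [mA pAE bE pAb b1]]]] := separating_set Tt ne.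
(* Half the gap, so that by lower semicontinuity the excess [e] persists on a ball around [th]. *)
pose e := (b - pA) / 2.
have e0 : 0 < e by rewrite /e; lra.
have pAe : pA + e <= 1 by rewrite /e; lra.
have [r r0 hr] : exists2 r, 0 < r & forall x, Th x -> ball th r x ->
    ((pA + e)%:E < \int[nu]_(y in A) (p x y)%:E)%E.
  apply: (@mass_lower_semicontinuous R k _ Y nu p Th th A) => //.
  - by move=> x Tx; split; [exact: mp|exact: p0].
  - by rewrite bE lte_fin /e; lra.
exists r => //.
(* The divergence is continuous at [ts] and vanishes there, so it is below the level required by the
   update inequality. *)
have near_ts : nbhs ts (fun x => [/\ U x, Th x & fine (KL nu p ts x) < e ^+ 2 / 8]).
  have hU : nbhs ts U by rewrite nbhsE; exists U.
  have hT : nbhs ts Th by [].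
  have hK : nbhs ts [set x | fine (KL nu p ts x) < e ^+ 2 / 8].
    have e8 : 0 < e ^+ 2 / 8 by rewrite divr_gt0// exprn_gt0.
    have /cvgrPdist_lt/(_ _ e8) := KLcont.
    by apply: filterS => x /=; rewrite KL_self sub0r normrN => /(le_lt_trans (ler_norm _)).
  by apply: filterS (filterI hU (filterI hT hK)) => x [? []].
move/nbhs_ballP: near_ts => [r1 /= r10 hr1].
pose U1 : set T := ball ts r1.
have mU1 : measurable U1 by apply: open_measurable_rV; exact: ball_open.
pose Gn n := U1 `&` good_set n.
have mGn n : measurable (Gn n) by apply: measurableI.
(* [U1] has positive prior mass and is covered by the sets [Gn n], so one of them is not null; it
   serves as the denominator of the odds. *)
have [n Gn0] : exists n, (0 < prior (Gn n))%E.
  apply: contrapT => /forallNP h.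
  have : prior.-negligible (\bigcup_n Gn n).
    apply: negligible_bigcup => n; exists (Gn n); split => //.
    by apply/eqP; rewrite eq_le measure_ge0 andbT leNgt; apply/negP; exact: h.
  move=> /negligibleS; move=> /(_ U1) hU1.
  have /hU1/(measure_negligible mU1) : U1 `<=` \bigcup_n Gn n.
    by move=> x xU; have [_ Tx _] := hr1 x xU; have [n gn] := good_cover Tx; exists n.
  have := @prior_nbhs_gt0 ts U1 mU1 (nbhsx_ballx ts r1 r10) ts_int.
  by rewrite lt0e => /andP[/eqP].
have mB : measurable ((ball th r : set T) `&` Th).
  by apply: measurableI => //; apply: open_measurable_rV; exact: ball_open.
have HA x : ((ball th r : set T) `&` Th) x ->
   ((pA + e)%:E <= \int[nu']_(y in A) (f (x, y))%:E)%E.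
  move=> [bx Tx]; under eq_integral do rewrite rdensityE//.
  by apply: ltW; exact: hr.
have Hn x : Gn n x -> nu' [set y | (0 < p ts y) &&
     ~~ (expR (- n%:R) * p ts y <= f (x, y) <= expR n%:R * p ts y)] = 0%E.
  move=> [_]; rewrite /good_set /= => h; rewrite -[RHS]h; congr (nu _).
  by apply/seteqP; split => y; rewrite /xsection/= inE/= /bad/=.
have Hkl x : Gn n x ->
     (\int[nu']_y (p ts y * ln (p ts y / f (x, y)))%:E <= (e ^+ 2 / 8)%:E)%E.
  move=> [xU _]; have [_ Tx kl] := hr1 x xU.
  under eq_integral do rewrite rdensityE//.
  rewrite -(KL_integral Tx).2 -[leLHS]fineK ?KLfin// lee_fin; exact: ltW.
have f1 x : (\int[nu']_y (f (x, y))%:E = 1)%E.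
  exact: (@p1 (retract Th x0 x) (@retract_in R k Th x0 x Th0)).
have odds_bd := @ae_bounded_odds _ _ T Y R Des prior f measurable_rdensity rdensity_ge0
  rdensity_bounded nu' f1 (p ts) mps ps0 (p1 Ts) _ (Gn n) A pA e n%:R _ mB (mGn n) mA pAE
  e0 pAe HA (ler0n _ _) Hn Hkl erefl _ Om P D Ys G F d mF GF GS mD mDF mY mYt obs.
have mUU : measurable (U : set T) by exact: open_measurable_rV.
apply: filterS2 odds_bd ae_likelihood_pos => w [K hK] pos; exists (Num.max K 0) => t.
have NU : 0 < fine (marg (Gn n) (D ^~ w) (Ys ^~ w) t d).
  by apply: marg_gt0 => // s _; exact: pos.
have := hK t; rewrite ler_pdivrMr// => /le_trans; apply.
apply: (@le_trans _ _ (Num.max K 0 * fine (marg (Gn n) (D ^~ w) (Ys ^~ w) t d))).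
  by rewrite ler_wpM2r ?(ltW NU)// le_max lexx.
rewrite ler_wpM2l ?le_max ?lexx ?orbT//.
by apply: marg_mono => // x [xU _]; have [] := hr1 x xU.
Qed.

(** Finitely many of the balls from [local_odds_bounded] cover [Th] minus [U]. The mass off [U] is
    then at most a random, time-independent multiple [K] of the mass of [U], so the posterior of [U]
    is at least [1 / (1 + K)]. *)
Lemma posterior_bounded_below (U : set V) : open U -> U ts ->
  {ae P, forall w, exists2 kappa : R, 0 < kappa &
    forall t, kappa <= post lam Th p (D ^~ w) (Ys ^~ w) t d U}.
Proof.
move=> oU Uts.
have mU : measurable (U : set T) by exact: open_measurable_rV.
have BdU (A B : set T) : measurable A -> measurable B -> Bd A U -> Bd B U -> Bd (A `|` B) U.
  rewrite /Bd => mA mB hA hB; apply: filterS2 hA hB => w [K hK] [L hL]; exists (K + L) => t.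
  have mAB : measurable (A `|` B) by exact: measurableU.
  apply: le_trans (marg_subadd _ _ _ _ mAB mA mB _) _; first by [].
  by rewrite mulrDl lerD.
have cK : compact (Th `&` ~` U) by apply: compact_closedI => //; exact: open_closedC.
have ex_r th : exists r : R, Th th /\ ~ U th -> 0 < r /\ Bd ((ball th r : set T) `&` Th) U.
  have [[Tt nU]|h] := pselect (Th th /\ ~ U th); last by exists 0.
  have ne : th <> ts by move=> E; apply: nU; rewrite E.
  by have [r r0 hr] := local_odds_bounded oU Uts Tt ne; exists r.
have [rad hrad] := choice ex_r.
move: cK; rewrite compact_cover => /(_ V (Th `&` ~` U) (fun c : V => ball c (rad c))).
case=> [c _|c Tc|D' subD covD].
- exact: ball_open.
- by exists c => //; apply: ballxx; exact: (hrad c Tc).1.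
pose W (s : seq V) : set T := \big[setU/set0]_(c <- s) ((ball c (rad c) : set T) `&` Th).
have mBall c r : measurable ((ball c r : set T) `&` (Th : set T)).
  by apply: measurableI => //; apply: open_measurable_rV; exact: ball_open.
have mW s : measurable (W s).
  by apply: bigsetU_measurable => c _; exact: mBall.
have BdW s : (forall c, c \in s -> (Th `&` ~` U) c) -> Bd (W s) U.
  elim: s => [|c s ih] hs.
    apply: aeW => w; exists 0 => t.
    by rewrite /W big_nil /marg integral_set0 /= mul0r.
  rewrite /W big_cons; apply: BdU => //.
  - exact: mW.
  - by apply: (hrad c _).2; apply: hs; rewrite mem_head.
  - by apply: ih => c' c's; apply: hs; rewrite inE c's orbT.
have hW : Bd (W (finmap.enum_fset D')) U.
  by apply: BdW => c cD; have := subD c cD; rewrite inE.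
have T_gt0 : (0 < prior setT)%E.
  by apply: (@prior_nbhs_gt0 ts setT) => //; exact: filterT.
rewrite /Bd in hW; apply: filterS2 hW ae_likelihood_pos => w [K hK] pos.
exists (1 + Num.max K 0)^-1.
  by rewrite invr_gt0 ltr_wpDr// le_max lexx orbT.
have K0 : 0 < 1 + Num.max K 0 by rewrite ltr_wpDr// le_max lexx orbT.
move=> t; rewrite postE//.
set NU := fine (marg U _ _ _ _); set NT := fine (marg setT _ _ _ _).
have NT0 : 0 < NT by apply: marg_gt0 => // s _; exact: pos.
rewrite ler_pdivlMr// -(ler_pM2l K0) mulrA divff ?gt_eqF// mul1r.
have mCT : measurable (~` (Th : set T)) by exact: measurableC.
have mWD := mW (finmap.enum_fset D').
have mCU : measurable (~` (U : set T)) by exact: measurableC.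
have h1 : NT <= NU + fine (marg (~` U) (D ^~ w) (Ys ^~ w) t d).
  by apply: marg_subadd => //; rewrite setUv.
have h2 : fine (marg (~` U) (D ^~ w) (Ys ^~ w) t d) <=
    fine (marg (W (finmap.enum_fset D')) (D ^~ w) (Ys ^~ w) t d)
    + fine (marg (~` Th) (D ^~ w) (Ys ^~ w) t d).
  apply: marg_subadd => // x nUx.
  have [Tx|] := pselect (Th x); last by right.
  left; have [c /= cD bx] := covD x (conj Tx nUx).
  by rewrite /W -bigcup_seq; exists c.
have h3 : fine (marg (~` Th) (D ^~ w) (Ys ^~ w) t d) = 0.
  by rewrite /marg ge0_integral_prior// setICl integral_set0.
have h4 : fine (marg (W (finmap.enum_fset D')) (D ^~ w) (Ys ^~ w) t d) <= Num.max K 0 * NU.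
  apply: le_trans (hK t) _; rewrite ler_wpM2r ?mge0// le_max lexx//.
by rewrite mulrDl mul1r; lra.
Qed.

Lemma ae_post_gt0 (B : set T) : measurable B -> (0 < prior B)%E ->
  {ae P, forall w, forall t, 0 < post lam Th p (D ^~ w) (Ys ^~ w) t d B}.
Proof.
move=> mB B0; apply: filterS ae_likelihood_pos => w pos t.
rewrite postE//; apply: divr_gt0; apply: marg_gt0 => //; try by move=> s _; exact: pos.
by apply: (@prior_nbhs_gt0 ts setT) => //; exact: filterT.
Qed.

End consistency.
End posterior.

(** * Recurrence of the selected design *)

Section integral_monotone.
Context d (T : measurableType d) (R : realType) (mu : {measure set T -> \bar R}).

(** Proved from the integral as a supremum over simple functions, so that it applies to [sel_prob]
    without a measurability proof for it. *)
Lemma ge0_cst_le_integral (E : set T) (f : T -> \bar R) (c : R) : measurable E ->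
  0 <= c -> (forall x, E x -> c%:E <= f x)%E -> (c%:E * mu E <= \int[mu]_(x in E) f x)%E.
Proof.
move=> mE c0 cf; have cE : (c%:E * mu E = \int[mu]_x (cst c%:E \_ E) x)%E.
  by rewrite -integral_mkcond integral_cst.
have f0 x : E x -> (0 <= f x)%E by move=> /cf; apply: le_trans; rewrite lee_fin.
rewrite cE [leRHS]integral_mkcond !ge0_integralTE; last 2 first.
- by move=> x; rewrite patchE; case: ifP => // /set_mem; exact: f0.
- by move=> x; rewrite patchE; case: ifP => // _; rewrite lee_fin.
apply: le_ereal_sup => _ [h hle <-]; exists h => // x; apply: le_trans (hle x) _.
by rewrite !patchE; case: ifP => // /set_mem; exact: cf.
Qed.

End integral_monotone.

(** * A conditional Borel-Cantelli argument *)

Section recurrence.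
Context dO (Om : measurableType dO) (R : realType) (P : probability Om R).
Variables (G : nat -> set (set Om)) (E : nat -> set Om) (kappa : nat -> Om -> R) (c : R).
Hypotheses (GM : forall t A, <<s G t >> A -> measurable A)
  (GS : forall t, G t `<=` <<s G t.+1 >>)
  (mE : forall t, <<s G t.+1 >> (E t))
  (mkappa : forall t, measurable_fun setT (kappa t : g_sigma_algebraType (G t) -> R))
  (c0 : 0 < c)
  (hit : forall t A, <<s G t >> A ->
     (c%:E * \int[P]_(w in A) (kappa t w)%:E <= P (A `&` E t))%E).

Let GG t : <<s G t >> `<=` <<s G t.+1 >>.
Proof. apply: smallest_sub; [exact: smallest_sigma_algebra|exact: GS]. Qed.

Let mEO t : measurable (E t). Proof. by apply: (@GM t.+1); exact: mE. Qed.

Let avoid t0 r t := [set w | forall s, (t0 <= s < t0 + t)%N -> ~ E s w /\ r <= kappa s w].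

Let avoidS t0 r t : avoid t0 r t.+1 =
  avoid t0 r t `&` [set w | r <= kappa (t0 + t)%N w] `\` E (t0 + t)%N.
Proof.
apply/seteqP; split => w /=.
  move=> h; have [|h1 h2] := h (t0 + t)%N; first by rewrite leq_addr addnS ltnSn.
  do 2 split => //.
  move=> s /andP[s1 s2]; apply: h; rewrite s1 addnS ltnS; exact: ltnW.
move=> [[h1 h2] h3] s /andP[s1]; rewrite addnS ltnS leq_eqVlt => /orP[/eqP ->//|s2].
by apply: h1; rewrite s1.
Qed.

Let Gkappa r t : <<s G t >> [set w | r <= kappa t w].
Proof.
have : @measurable _ (g_sigma_algebraType (G t)) [set w | r <= kappa t w].
  by apply: measurable_pred; apply: measurable_fun_ler.
by [].
Qed.

Let Gavoid t0 r t : <<s G (t0 + t)%N >> (avoid t0 r t).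
Proof.
elim: t => [|t ih].
  rewrite (_ : avoid t0 r 0 = setT); last first.
    by apply/seteqP; split => w // _ s; rewrite addn0 => /andP[s1 s2]; rewrite ltnNge s1 in s2.
  exact: (@measurableT _ (g_sigma_algebraType (G (t0 + 0)%N))).
rewrite avoidS addnS; apply: (@measurableD _ (g_sigma_algebraType (G (t0 + t).+1))).
  by apply: GG; apply: (@measurableI _ (g_sigma_algebraType (G (t0 + t)%N))); [exact: ih|exact: Gkappa].
exact: mE.
Qed.

(** The surviving event with [r <= kappa] belongs to the past, so [hit] removes at least a fraction
    [c * r] of it at each step. *)
Let avoid_decay t0 r t : 0 < r -> c * r <= 1 ->
  (P (avoid t0 r t) <= ((1 - c * r) ^+ t)%:E)%E.
Proof.
move=> r0 cr1; elim: t => [|t ih].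
  by rewrite expr0; apply: probability_le1; apply: (GM (t := (t0 + 0)%N)); exact: Gavoid.
set A := avoid t0 r t `&` [set w | r <= kappa (t0 + t)%N w].
have GA : <<s G (t0 + t)%N >> A.
  by apply: (@measurableI _ (g_sigma_algebraType (G (t0 + t)%N))); [exact: Gavoid|exact: Gkappa].
have mA : measurable A by exact: GM GA.
have PAfin : P A \is a fin_num by exact: fin_num_measure.
have h1 : ((c * r)%:E * P A <= P (A `&` E (t0 + t)%N))%E.
  apply: le_trans (hit GA); rewrite EFinM -muleA; apply: lee_wpmul2l; first by rewrite lee_fin ltW.
  by apply: ge0_cst_le_integral => //; [exact: ltW|move=> w []].
have h2 : (P A = P (avoid t0 r t.+1) + P (A `&` E (t0 + t)%N))%E.
  rewrite avoidS -/A -measureU//.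
  - by rewrite setDE -setIUr setUC setUv setIT.
  - exact: measurableD.
  - exact: measurableI.
  - by apply/seteqP; split => w // -[[_ h] [_ h']].
have h3 : (P (avoid t0 r t.+1) <= (1 - c * r)%:E * P A)%E.
  have mav : measurable (avoid t0 r t.+1) by apply: (GM (t := (t0 + t.+1)%N)); exact: Gavoid.
  have f1 : P (avoid t0 r t.+1) \is a fin_num by exact: fin_num_measure.
  have f2 : P (A `&` E (t0 + t)%N) \is a fin_num.
    by apply: fin_num_measure; exact: measurableI.
  move: h1 h2; rewrite -(fineK PAfin) -(fineK f1) -(fineK f2) -!EFinM -EFinD lee_fin.
  by move=> h1 [h2]; rewrite lee_fin; lra.
apply: le_trans h3 _; rewrite exprS EFinM; apply: lee_wpmul2l.
  by rewrite lee_fin subr_ge0.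
apply: le_trans ih; apply: le_measure; rewrite ?inE//.
  by apply: (GM (t := (t0 + t)%N)); exact: Gavoid.
by move=> w [].
Qed.

(** For each of the countably many pairs [t0], [n], avoiding [E] forever has probability below every
    term of a geometric sequence. *)
Lemma ae_recurrent : {ae P, forall w, forall t0 n,
  ~ (forall t, (t0 <= t)%N -> ~ E t w /\ n.+1%:R^-1 <= kappa t w)}.
Proof.
have bad t0 n : P.-negligible [set w | forall t, (t0 <= t)%N -> ~ E t w /\ n.+1%:R^-1 <= kappa t w].
  (* The cap [c^-1] keeps the ratio [1 - c * r] nonnegative. *)
  pose r : R := Num.min n.+1%:R^-1 c^-1.
  have r0 : 0 < r by rewrite lt_min !invr_gt0 ltr0Sn.
  have cr1 : c * r <= 1 by rewrite -ler_pdivlMl// mulr1 ge_min lexx orbT.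
  pose B := \bigcap_t avoid t0 r t.
  have mav t : measurable (avoid t0 r t) by apply: (GM (t := (t0 + t)%N)); exact: Gavoid.
  exists B; split.
  - exact: bigcap_measurable.
  - apply/eqP; rewrite eq_le measure_ge0 andbT.
    have le t : (P B <= ((1 - c * r) ^+ t)%:E)%E.
      apply: le_trans (avoid_decay t0 t r0 cr1).
      by apply: le_measure; rewrite ?inE//; [exact: bigcap_measurable|exact: bigcap_inf].
    have cv : ((1 - c * r) ^+ t)%:E @[t --> \oo] --> (0 : R)%:E.
      apply: cvg_EFin; first exact: nearW.
      apply: cvg_expr; rewrite ger0_norm ?subr_ge0//.
      by rewrite ltrBlDr ltrDl mulr_gt0.
    suff : (P B <= (0 : R)%:E)%E by [].
    rewrite -(cvg_lim _ cv)//; apply: lime_ge; first by apply/cvg_ex; eexists; exact: cv.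
    exact: nearW.
  - move=> w h t _ s /andP[s1 _]; have [h1 h2] := h s s1; split => //.
    by apply: le_trans h2; rewrite /r ge_min lexx.
have := negligible_bigcup (fun t0 => negligible_bigcup (fun n => bad t0 n)).
apply: negligibleS => w /= /existsNP[t0 /existsNP[n /contrapT h]].
by exists t0 => //; exists n.
Qed.

End recurrence.

(** * The selection rule under two opposite rankings *)

Section selection.
Context (R : realType) (k : nat) (Ctx Des : finType) (ctx : Des -> Ctx) (m : Ctx -> nat).
Hypothesis Hm : forall c, (0 < m c)%N /\ (m c < #|[set d | ctx d == c]|)%N.

Let card_mkset (b : pred Des) : #|[set e | b e]| = #|b|.
Proof.
by apply: eq_card => e; apply/idP/idP => [/set_mem //|be]; exact: mem_set.
Qed.

Lemma in_topset (mu : Des -> R) d : (forall e, e != d -> mu e < mu d) ->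
  d \in topset ctx m mu (ctx d).
Proof.
move=> h; rewrite finset.inE eqxx/= card_mkset eq_card0 ?(Hm _).1// => e.
apply/negP; rewrite unfold_in => /andP[_ lt].
have [E|ne] := eqVneq e d; first by rewrite E ltxx in lt.
by have := lt_trans lt (h e ne); rewrite ltxx.
Qed.

(** A design ranked last is beaten by all the others of its context, and these number at least
    [m (ctx d)] by the strict inequality in [Hm]. *)
Lemma notin_topset (mu : Des -> R) d : (forall e, e != d -> mu d < mu e) ->
  d \notin topset ctx m mu (ctx d).
Proof.
move=> h; rewrite finset.inE eqxx/= -leqNgt card_mkset.
have [_] := Hm (ctx d); rewrite card_mkset (cardD1 d) unfold_in eqxx add1n ltnS.
move=> /leq_trans; apply; apply: subset_leq_card; apply/fintype.subsetP => e.
by rewrite !inE !unfold_in => /andP[ne ->]; exact: h.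
Qed.

Lemma first_index1 (Q : pred nat) : ~~ Q 0%N -> Q 1%N -> first_index Q = Some 1%N.
Proof.
move=> Q0 Q1; rewrite /first_index; case: pselect => [h|]; last by case; exists 1%N.
congr Some; case: ex_minnP => -[|[|j]] Qj hmin //; first by rewrite Qj in Q0.
by have := hmin _ Q1.
Qed.

(** Opposite rankings of [d] put [ctx d] in [Delta], so the first redraw is accepted. The three
    factors bound the uniform choice of context, the larger of [g] and [1 - g], and the uniform
    choice of design. *)
Lemma sel_prob_ge (th : nat -> Des -> 'rV[R]_k.+1) (g : Ctx -> R) d :
  0 < g (ctx d) < 1 ->
  let up j := forall e, e != d -> mu_of (th j e) < mu_of (th j d) in
  let down j := forall e, e != d -> mu_of (th j d) < mu_of (th j e) in
  (g (ctx d) < 1/2 /\ down 0%N /\ up 1%N) \/ (1/2 <= g (ctx d) /\ up 0%N /\ down 1%N) ->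
  (#|Ctx|%:R^-1 * (2^-1 * #|Des|%:R^-1)) <= sel_prob ctx m th g (ctx d) d.
Proof.
move=> /andP[g0 g1] up down H.
set mu1 := fun e => mu_of (th 0%N e); set mu2 := fun e => mu_of (th 1%N e).
have Dc : ctx d \in Delta ctx m mu1 mu2.
  rewrite finset.inE; apply/eqP => E; case: H => -[_ [h1 h2]].
    by have := notin_topset h1; rewrite -/mu1 E (in_topset h2).
  by have := in_topset h1; rewrite -/mu1 E (negbTE (notin_topset h2)).
have D0 : (0 < #|Delta ctx m mu1 mu2|)%N by rewrite card_gt0; apply/set0Pn; exists (ctx d).
rewrite /sel_prob first_index1//= -/mu1 -/mu2 Dc.
set Dl := Delta _ _ _ _ in D0 *; set P1 := topset _ _ mu1 _; set P2 := topset _ _ mu2 _.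
have inv_le (T : finType) (X : {set T}) : (0 < #|X|)%N -> (#|T|%:R^-1 <= #|X|%:R^-1 :> R).
  move=> X0; have T0 : (0 < #|T|)%N by apply: leq_trans X0 (max_card _).
  by rewrite lef_pV2 ?posrE ?ltr0n// ler_nat max_card.
have card_in (X : {set Des}) : d \in X -> (#|Des|%:R^-1 <= #|X|%:R^-1 :> R).
  by move=> dX; apply: inv_le; rewrite card_gt0; apply/set0Pn; exists d.
rewrite mul1r; apply: ler_pM; rewrite ?invr_ge0 ?mulr_ge0 ?invr_ge0//.
  exact: inv_le.
have t0 (b : bool) (n : nat) : 0 <= b%:R / n%:R :> R by rewrite divr_ge0.
case: H => -[hg [h1 h2]].
  have dP : d \in (P2 :\: P1)%SET by rewrite finset.inE (in_topset h2) notin_topset.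
  rewrite dP; apply: ler_wpDl; first by rewrite mulr_ge0 ?t0// ltW.
  rewrite mul1r; apply: ler_pM; rewrite ?invr_ge0//; last exact: card_in.
  by lra.
have dP : d \in (P1 :\: P2)%SET by rewrite finset.inE (in_topset h1) notin_topset.
rewrite dP; apply: ler_wpDr; first by rewrite mulr_ge0 ?t0// subr_ge0 ltW.
rewrite mul1r; apply: ler_pM; rewrite ?invr_ge0//; last exact: card_in.
by lra.
Qed.

End selection.

Section misc.
Context {R : realType}.

Lemma count_diverges (b : nat -> bool) : (forall t0, exists2 t, (t0 <= t)%N & b t) ->
  (fun n : nat => (\sum_(t < n) (b t : nat)%:R : R)) @ \oo --> +oo.
Proof.
move=> io.
have mono n n' : (n <= n')%N -> \sum_(t < n) (b t : nat)%:R <= \sum_(t < n') (b t : nat)%:R :> R.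
  move=> /subnKC <-; rewrite big_split_ord /= lerDl.
  by apply: sumr_ge0 => i _; rewrite ler0n.
have big n : exists N, n%:R <= \sum_(t < N) (b t : nat)%:R :> R.
  elim: n => [|n [N hN]]; first by exists 0%N; rewrite big_ord0.
  have [t Nt bt] := io N; exists t.+1; rewrite big_ord_recr /= bt -natr1 lerD2r.
  exact: le_trans hN (mono _ _ Nt).
apply/cvgryPge => A.
have [N hN] := big (Num.bound `|A|).
exists N => // n /= Nn; apply: le_trans (mono _ _ Nn); apply: le_trans hN.
apply: le_trans (ler_norm A) _; apply: ltW; exact: archi_boundP.
Qed.

(** A design that is not selected receives no new likelihood factor. *)
Lemma post_stable k (Des : finType) (Y : Type) (lam : {measure set (Borel_rV R k.+1) -> \bar R})
    Th (p : 'rV[R]_k.+1 -> Y -> R) (Ds : nat -> Des) (Ys : nat -> Y) t0 t d B :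
  (t0 <= t)%N -> (forall s, (t0 <= s)%N -> Ds s <> d) ->
  post lam Th p Ds Ys t d B = post lam Th p Ds Ys t0 d B.
Proof.
move=> /subnKC <- h; elim: (t - t0)%N => [|u ih]; first by rewrite addn0.
rewrite addnS -ih /post.
suff -> : lik p Ds Ys (t0 + u).+1 d = lik p Ds Ys (t0 + u) d by [].
apply/funext => th; rewrite /lik big_mkcond big_ord_recr /= -big_mkcond/=.
by case: eqP => [/h|_]; rewrite ?leq_addr ?mulr1//; case.
Qed.

Context {k : nat}.
Implicit Types (Th : set 'rV[R]_k.+1) (x : 'rV[R]_k.+1).

Lemma open_mu_gt (a : R) : open [set x : 'rV[R]_k.+1 | a < mu_of x].
Proof.
have : open ((fun x : 'rV[R]_k.+1 => x 0 0) @^-1` [set y | a < y]).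
  by apply: open_comp; [move=> x _; exact: coord_continuous|exact: open_gt].
by [].
Qed.

Lemma open_mu_lt (a : R) : open [set x : 'rV[R]_k.+1 | mu_of x < a].
Proof.
have : open ((fun x : 'rV[R]_k.+1 => x 0 0) @^-1` [set y | y < a]).
  by apply: open_comp; [move=> x _; exact: coord_continuous|exact: open_lt].
by [].
Qed.

(** Supplies interior parameters whose mean is strictly larger, or strictly smaller, than that of
    [x]. *)
Lemma interior_shift Th x : interior Th x -> exists2 r : R, 0 < r &
  interior Th (x + const_mx r) /\ interior Th (x + const_mx (- r)).
Proof.
move=> /nbhs_ballP[r /= r0 sub]; exists (r / 2); first by rewrite divr_gt0.
have inb y : ball x r y -> interior Th y.
  move=> by_; apply: (@filterS _ _ _ (ball x r)) => //.
  by apply: open_nbhs_nbhs; split => //; exact: ball_open.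
have r2 : r / 2 < r by rewrite ltr_pdivrMr// ltr_pMr// ltr1n.
split; apply: inb; rewrite /ball /=; split => // i j; rewrite /ball/= !mxE.
  by rewrite opprD addrA subrr sub0r normrN gtr0_norm// divr_gt0.
by rewrite opprD opprK addrA subrr add0r gtr0_norm// divr_gt0.
Qed.

End misc.

(** * Conditional probability of selecting a given design *)

Section sampling.
Context (R : realType) (k : nat) (Ctx Des : finType) (ctx : Des -> Ctx) (m : Ctx -> nat).
Hypothesis Hm : forall c, (0 < m c)%N /\ (m c < #|[set d | ctx d == c]|)%N.
Local Notation V := 'rV[R]_k.+1.
Local Notation T := (Borel_rV R k.+1).
Context dO (Om : measurableType dO) (P : probability Om R).
Variables (C : nat -> Om -> Ctx) (D : nat -> Om -> Des)
  (Th : nat -> nat -> Om -> Des -> V) (gam : nat -> Ctx -> Om -> R)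
  (G : nat -> set (set Om)) (pst : nat -> Om -> Des -> set T -> R).
Hypotheses (mF : forall t A, <<s G t `|` draw_gen Th t.+1 >> A -> measurable A)
  (HDmeas : forall t d, measurable (D t @^-1` [set d]))
  (HCmeas : forall t d, measurable (C t @^-1` [set d]))
  (Hgam : forall t c w, 0 < gam t c w < 1)
  (Hgam_meas : forall t c (B : set R), measurable B -> <<s G t >> (gam t c @^-1` B))
  (pst_ge0 : forall t w e (B : set T), measurable B -> 0 <= pst t w e B)
  (pst_meas : forall t e (B : set T), measurable B ->
     measurable_fun setT (fun w : g_sigma_algebraType (G t) => pst t w e B))
  (Hdraw : forall t (A : set Om), <<s G t >> A ->
     forall (J : nat) (B : nat -> Des -> set T),
       (forall j e, measurable (B j e)) ->
       P (A `&` [set w | forall j, (j <= J)%N -> forall e, B j e (Th t j w e)])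
       = (\int[P]_(w in A) (\prod_(j < J.+1) \prod_(e : Des) pst t w e (B j e))%:E)%E)
  (Hsel : forall t (A : set Om), <<s G t `|` draw_gen Th t.+1 >> A ->
     forall c d, P (A `&` [set w | C t w = c /\ D t w = d])
       = (\int[P]_(w in A)
            (sel_prob ctx m (fun j e => Th t j w e) (fun c' => gam t c' w) c d)%:E)%E).
Variables (d : Des) (lo hi : R).

Definition between : set V := [set x | lo < mu_of x] `&` [set x | mu_of x < hi].
Definition above : set V := ~` [set x | mu_of x < hi].
Definition below : set V := ~` [set x | lo < mu_of x].

Lemma measurable_between : measurable (between : set T).
Proof.
by apply: open_measurable_rV; apply: openI; [exact: open_mu_gt|exact: open_mu_lt].
Qed.

Lemma measurable_above : measurable (above : set T).
Proof. by apply: measurableC; apply: open_measurable_rV; exact: open_mu_lt. Qed.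

Lemma measurable_below : measurable (below : set T).
Proof. by apply: measurableC; apply: open_measurable_rV; exact: open_mu_gt. Qed.

(* Draws in [target true] rank [d] first in its context, draws in [target false] rank it last. *)
Definition target (top : bool) (e : Des) : set T :=
  if e == d then (if top then above else below) else between.

Lemma measurable_target top e : measurable (target top e).
Proof.
rewrite /target; case: ifP => _; last exact: measurable_between.
by case: top; [exact: measurable_above|exact: measurable_below].
Qed.

(** Conditional probability that two independent draws fall in the two targets in a prescribed
    order; being a product, it is the same for both orders. *)
Definition exploration t w : R :=
  \prod_(e : Des) pst t w e (target false e) * \prod_(e : Des) pst t w e (target true e).

Lemma exploration_ge0 t w : 0 <= exploration t w.
Proof.
by apply: mulr_ge0; apply: prodr_ge0 => e _; apply: pst_ge0; exact: measurable_target.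
Qed.

Lemma measurable_exploration t :
  measurable_fun setT (exploration t : g_sigma_algebraType (G t) -> R).
Proof.
by apply: measurable_funM; apply: measurable_prod => e _; apply: pst_meas; exact: measurable_target.
Qed.

Let GF t : <<s G t >> `<=` <<s G t `|` draw_gen Th t.+1 >>.
Proof.
apply: smallest_sub; first exact: smallest_sigma_algebra.
by move=> A GA; apply: sub_sigma_algebra; left.
Qed.

Let mG t A : <<s G t >> A -> measurable A.
Proof. by move=> /GF; exact: mF. Qed.

Let rate : R := #|Ctx|%:R^-1 * (2^-1 * #|Des|%:R^-1).

Lemma rate_gt0 : 0 < rate.
Proof.
have D0 : (0 < #|Des|)%N by apply/card_gt0P; exists d.
have C0 : (0 < #|Ctx|)%N by apply/card_gt0P; exists (ctx d).
by rewrite /rate !mulr_gt0 ?invr_gt0 ?ltr0n.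
Qed.

(** [conf] prescribes the first draw and the first redraw, [b] giving their order. [Hdraw] evaluates
    its probability and, given [conf], [sel_prob_ge] bounds the selection of [d] from below. *)
Let hit_half (b : bool) t A : <<s G t >> A ->
  (forall w, A w -> if b then 1/2 <= gam t (ctx d) w else gam t (ctx d) w < 1/2) ->
  (rate%:E * \int[P]_(w in A) (exploration t w)%:E <= P (A `&` D t @^-1` [set d]))%E.
Proof.
move=> GA gA.
pose B j e := target (if j == 0%N then b else ~~ b) e.
pose conf := [set w | forall j, (j <= 1)%N -> forall e, B j e (Th t j w e)].
have mB j e : measurable (B j e) by exact: measurable_target.
have := Hdraw GA 1 mB; rewrite -/conf.
have -> : (\int[P]_(w in A) (\prod_(j < 2) \prod_(e : Des) pst t w e (B j e))%:E =
   \int[P]_(w in A) (exploration t w)%:E)%E.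
  apply: eq_integral => w _; congr EFin.
  rewrite big_ord_recl big_ord1 /= /exploration /B /=.
  by case: (b) => //=; rewrite mulrC.
move=> <-.
have Gconf : <<s G t `|` draw_gen Th t.+1 >> conf.
  have : @measurable _ (g_sigma_algebraType (G t `|` draw_gen Th t.+1)) conf.
    rewrite (_ : conf = \bigcap_(j in `I_2) \bigcap_(e in [set: Des])
        ((fun w => Th t j w e) @^-1` B j e)).
      apply: fin_bigcap_measurable => [|j _]; first exact: finite_II.
      apply: fin_bigcap_measurable => [|e _]; first exact: finite_finset.
      apply: sub_sigma_algebra; right; exists t, j, e, (B j e); split => //.
    by apply/seteqP; split => w /= h j; [move=> j2 e _; exact: h|move=> j1 e; exact: (h j j1 e I)].
  by [].
have GAc : <<s G t `|` draw_gen Th t.+1 >> (A `&` conf).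
  apply: (@measurableI _ (g_sigma_algebraType (G t `|` draw_gen Th t.+1))) => //.
  exact: GF.
have mAc := mF GAc.
apply: (@le_trans _ _ (P ((A `&` conf) `&` [set w | C t w = ctx d /\ D t w = d]))).
  rewrite Hsel//; apply: ge0_cst_le_integral => //; first exact: ltW rate_gt0.
  move=> w [Aw cw]; rewrite lee_fin; apply: sel_prob_ge => //.
  have cd j e : (j <= 1)%N -> e != d -> between (Th t j w e).
    by move=> j1 ne; have := cw j j1 e; rewrite /B /target (negbTE ne).
  have up j : (j <= 1)%N -> (if j == 0%N then b else ~~ b) ->
      forall e, e != d -> mu_of (Th t j w e) < mu_of (Th t j w d).
    move=> j1 bj e ne; have [_ h1] := cd j e j1 ne.
    have := cw j j1 d; rewrite /B /target eqxx bj /above /= => /negP; rewrite -leNgt.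
    exact: lt_le_trans.
  have down j : (j <= 1)%N -> ~~ (if j == 0%N then b else ~~ b) ->
      forall e, e != d -> mu_of (Th t j w d) < mu_of (Th t j w e).
    move=> j1 /negbTE bj e ne; have [h1 _] := cd j e j1 ne.
    have := cw j j1 d; rewrite /B /target eqxx bj /below /= => /negP; rewrite -leNgt => h.
    exact: le_lt_trans h h1.
  have := gA w Aw; case: (b) up down => up down gw; [right|left]; split => //; split.
  - exact: (up 0%N).
  - exact: (down 1%N).
  - exact: (down 0%N).
  - exact: (up 1%N).
apply: le_measure; rewrite ?inE//.
- apply: measurableI => //.
  rewrite (_ : [set w | _] = C t @^-1` [set ctx d] `&` D t @^-1` [set d]); first exact: measurableI.
  by apply/seteqP; split.
- by apply: measurableI => //; exact: mG GA.
- by move=> w [[Aw _] [_ Dw]].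
Qed.

(* Whatever the value of gamma_t, one of the two orders of the pair of draws makes
   [d] selected with probability at least 1/2 among the two candidates. *)
Lemma hit_probability t A : <<s G t >> A ->
  (rate%:E * \int[P]_(w in A) (exploration t w)%:E <= P (A `&` D t @^-1` [set d]))%E.
Proof.
(* Since [gam t] is measurable with respect to the past, both halves of [A] are past events, as
   [hit_half] requires. *)
move=> GA; pose S := gam t (ctx d) @^-1` [set x | x < 1/2].
have GS : <<s G t >> S.
  apply: Hgam_meas; rewrite (_ : [set x | _] = [set` `]-oo, (1/2 : R)[ ]).
    exact: measurable_itv.
  by apply/seteqP; split => x /=; rewrite in_itv.
have G1 : <<s G t >> (A `&` S) by apply: (@measurableI _ (g_sigma_algebraType (G t))).
have G2 : <<s G t >> (A `\` S) by apply: (@measurableD _ (g_sigma_algebraType (G t))).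
have m1 := mG G1; have m2 := mG G2.
have mex : measurable_fun setT (exploration t : Om -> R).
  by move=> _ Z mZ; apply: (@mG t); exact: (measurable_exploration measurableT mZ).
have E : A = (A `&` S) `|` (A `\` S) by rewrite setDE -setIUr setUv setIT.
rewrite [X in (\int[P]_(w in X) _)%E]E [X in P (X `&` _)]E ge0_integral_setU//; last 3 first.
- by apply/measurable_EFinP; exact: measurable_funTS.
- by move=> w _; rewrite lee_fin exploration_ge0.
- by rewrite disj_set2E; apply/eqP/seteqP; split => w // -[[_ h] [_ h']].
rewrite ge0_muleDr; last 2 first.
- by apply: integral_ge0 => w _; rewrite lee_fin exploration_ge0.
- by apply: integral_ge0 => w _; rewrite lee_fin exploration_ge0.
rewrite setIUl measureU//; last 3 first.
- by apply: measurableI => //; exact: HDmeas.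
- by apply: measurableI => //; exact: HDmeas.
- by apply/seteqP; split => w // -[[[_ h] _] [[_ h'] _]].
apply: leeD.
- by apply: (hit_half (b := false)) => // w [].
- by apply: (hit_half (b := true)) => // w [_ /= /negP]; rewrite -leNgt.
Qed.

End sampling.

Unset Implicit Arguments.

Theorem mainTheorem11
  (R : realType)
  (* contexts, designs, D_c = [set d | ctx d == c], integers m_c *)
  (Ctx Des : finType) (ctx : Des -> Ctx) (m : Ctx -> nat)
  (Hm : forall c, (0 < m c)%N /\ (m c < #|[set d | ctx d == c]|)%N)
  (* parameter space Theta = M x H inside R^(1+k), Lebesgue measure on it *)
  (k : nat) (M : set R) (H : set 'rV[R]_k)
  (lam : {measure set (Borel_rV R k.+1) -> \bar R})
  (Hlam : is_lebesgue_rV lam)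
  (* observation space, dominating measure, densities p(y | theta) *)
  (dY : measure_display) (Y : measurableType dY)
  (nu : {measure set Y -> \bar R}) (Hnu : sigma_finite setT nu)
  (p : 'rV[R]_k.+1 -> Y -> R)
  (Hp : forall th, ParSpace M H th ->
     [/\ forall y, 0 <= p th y, measurable_fun setT (p th)
       & (\int[nu]_y (p th y)%:E)%E = 1%E])
  (* Assumption 1 *)
  (Hcompact : compact (ParSpace M H))
  (Hboundary : lam ((closure (ParSpace M H) `\` interior (ParSpace M H))
                    : set (Borel_rV R k.+1)) = 0%E)
  (Hcont : forall y, {within ParSpace M H, continuous (fun th => p th y)})
  (Hident : forall th th', ParSpace M H th -> ParSpace M H th' -> th <> th' ->
     exists B : set Y, measurable B /\
       (\int[nu]_(y in B) (p th y)%:E)%E <> (\int[nu]_(y in B) (p th' y)%:E)%E)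
  (HGC : universal_GC (LLR (ParSpace M H) p))
  (* true parameters: interior, with distinct means *)
  (thstar : Des -> 'rV[R]_k.+1)
  (Hinterior : forall d, interior (ParSpace M H) (thstar d))
  (Hdistinct : injective (fun d => mu_of (thstar d)))
  (* Assumption 2 *)
  (HKLfin : forall d th, ParSpace M H th -> KL nu p (thstar d) th \is a fin_num)
  (HKLC1 : forall d, C1_on (interior (ParSpace M H))
                           (fun th => fine (KL nu p (thstar d) th)))
  (* the probability space and the TTTS-C process (steps t = 0, 1, 2, ...) *)
  (dO : measure_display) (Om : measurableType dO) (P : probability Om R)
  (C : nat -> Om -> Ctx) (D : nat -> Om -> Des) (Ys : nat -> Om -> Y)
  (* Th t 0 = theta_hat_1 at step t; Th t j (j >= 1) = j-th redraw of theta_hat_2 *)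
  (Th : nat -> nat -> Om -> Des -> 'rV[R]_k.+1)
  (gam : nat -> Ctx -> Om -> R)
  (HCmeas : forall t c, measurable (C t @^-1` [set c]))
  (HDmeas : forall t d, measurable (D t @^-1` [set d]))
  (HYmeas : forall t, measurable_fun setT (Ys t))
  (HThmeas : forall t j d,
     measurable_fun setT ((fun w => Th t j w d) : Om -> Borel_rV R k.+1))
  (* gamma_t(c) in (0,1), E_{t-1}-measurable *)
  (Hgam : forall t c w, 0 < gam t c w < 1)
  (Hgam_meas : forall t c (B : set R), measurable B ->
     <<s obs_gen C D Ys t >> (gam t c @^-1` B))
  (* step 1-2: given the whole past, Th t 0, Th t 1, ... are i.i.d. ~ Pi_{t-1} *)
  (Hdraw : forall t (A : set Om), <<s obs_gen C D Ys t `|` draw_gen Th t >> A ->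
     forall (J : nat) (B : nat -> Des -> set (Borel_rV R k.+1)),
       (forall j d, measurable (B j d)) ->
       P (A `&` [set w | forall j, (j <= J)%N -> forall d, B j d (Th t j w d)])
       = (\int[P]_(w in A)
            (\prod_(j < J.+1) \prod_(d : Des)
               post lam (ParSpace M H) p (D ^~ w) (Ys ^~ w) t d (B j d))%:E)%E)
  (* steps 3-5: choice of (C_t, D_t) given the past and the draws of step t *)
  (Hsel : forall t (A : set Om), <<s obs_gen C D Ys t `|` draw_gen Th t.+1 >> A ->
     forall c d,
       P (A `&` [set w | C t w = c /\ D t w = d])
       = (\int[P]_(w in A)
            (sel_prob ctx m (fun j e => Th t j w e) (fun c' => gam t c' w) c d)%:E)%E)
  (* observation Y_t ~ p(. | theta*_{D_t}), independently of everything else *)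
  (Hobs : forall t (A : set Om),
     <<s obs_gen C D Ys t `|` draw_gen Th t.+1 `|` cd_gen C D t >> A ->
     forall B : set Y, measurable B ->
       P (A `&` (Ys t @^-1` B))
       = (\int[P]_(w in A) (\int[nu]_(y in B) (p (thstar (D t w)) y)%:E))%E) :
  forall (c : Ctx) (d : Des), ctx d = c ->
    {ae P, forall w,
      (fun T : nat => (\sum_(t < T) ((D t w == d) : nat)%:R : R)) @ \oo --> +oo}.
Proof.
move=> c d _.
set Theta := ParSpace M H in Hp Hcompact Hboundary Hcont Hident HGC Hinterior HKLfin HKLC1 Hdraw *.
have Tstar e : Theta (thstar e) by exact: interior_subset.
have p0 th (hth : Theta th) y : 0 <= p th y by have [h _ _] := Hp _ hth.
have mp th (hth : Theta th) : measurable_fun setT (p th) by have [_ h _] := Hp _ hth.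
have p1 th (hth : Theta th) : (\int[nu]_y (p th y)%:E = 1)%E by have [_ _ h] := Hp _ hth.
pose G t := obs_gen C D Ys t.
(* Everything known when [Ys t] is drawn, including the draws and the choice of step [t]. *)
pose F t := obs_gen C D Ys t `|` draw_gen Th t.+1 `|` cd_gen C D t.
have sub_meas (K : set (set Om)) : (forall A, K A -> measurable A) ->
    forall A, <<s K >> A -> measurable A.
  by move=> h; apply: smallest_sub => //; exact: sigma_algebra_measurable.
have obs_meas t A : obs_gen C D Ys t A -> measurable A.
  move=> [s _ [[c' ->]|[[e ->]|[B [mB ->]]]]] //.
  by rewrite -[X in measurable X]setTI; exact: HYmeas.
have draw_meas t A : draw_gen Th t A -> measurable A.
  move=> [s [j [e [B [_ mB ->]]]]].
  by rewrite -[X in measurable X]setTI; exact: HThmeas.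
have mF0 t A : <<s G t `|` draw_gen Th t.+1 >> A -> measurable A.
  by apply: sub_meas => X [/obs_meas|/draw_meas].
have mF t A : <<s F t >> A -> measurable A.
  by apply: sub_meas => X [[/obs_meas|/draw_meas]|[[c' ->]|[e ->]]].
have GF t : G t `<=` <<s F t >>.
  by move=> A GA; apply: sub_sigma_algebra; left; left.
have GS t : G t `<=` <<s G t.+1 >>.
  move=> A [s st h]; apply: sub_sigma_algebra; exists s => //; exact: ltnW.
have mD e t s : (s < t)%N -> <<s G t >> (D s @^-1` [set e]).
  by move=> st; apply: sub_sigma_algebra; exists s => //; right; left; exists e.
have mDF e t : <<s F t >> (D t @^-1` [set e]).
  by apply: sub_sigma_algebra; right; right; exists e.
have mY t s : (s < t)%N -> measurable_fun setT (Ys s : g_sigma_algebraType (G t) -> Y).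
  move=> st _ B mB; rewrite setTI; apply: sub_sigma_algebra; exists s => //.
  by right; right; exists B.
have obs e t X Z : <<s F t >> X -> X `<=` D t @^-1` [set e] -> measurable Z ->
    P (X `&` Ys t @^-1` Z) = (P X * \int[nu]_(y in Z) (p (thstar e) y)%:E)%E.
  move=> FX XD mZ; rewrite (Hobs t X FX Z mZ).
  transitivity (\int[P]_(w in X) (cst (\int[nu]_(y in Z) (p (thstar e) y)%:E) w))%E.
    by apply: eq_integral => w /set_mem Xw; rewrite /= (XD w Xw).
  by rewrite integral_cst; [rewrite muleC|exact: mF FX].
have ident e th : Theta th -> th <> thstar e -> exists B : set Y, measurable B /\
    (\int[nu]_(y in B) (p th y)%:E)%E <> (\int[nu]_(y in B) (p (thstar e) y)%:E)%E.
  by move=> hth ne; exact: Hident.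
have llr e th : Theta th ->
    exists2 K : R, 0 <= K & forall y, `|ln (p (thstar e) y / p th y)| <= K.
  move=> hth; apply: universally_integrable_bounded.
    apply: (measurableT_comp (@measurable_ln R)).
    by apply: measurable_fun_div; [exact: p0|exact: mp|exact: mp].
  move=> Q; have [h _] := HGC Q; apply: h.
  by exists (thstar e), th.
have KLcont e : {for thstar e, continuous (fun th => fine (KL nu p (thstar e) th))}.
  by have [h _] := HKLC1 e; apply: differentiable_continuous; exact: h.
pose Prior := prior Hlam Hcompact.
have [emax _ maxP] := arg_maxP (fun e => mu_of (thstar e)) (erefl : xpredT d).
have [emin _ minP] := arg_minP (fun e => mu_of (thstar e)) (erefl : xpredT d).
have [r1 r10 [up_int _]] := interior_shift (Hinterior emax).
have [r2 r20 [_ down_int]] := interior_shift (Hinterior emin).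
(* With half the shift, every true mean lies strictly between [lo] and [hi], while means beyond
   either end keep positive prior mass, because the fully shifted parameters are interior. *)
pose hi : R := mu_of (thstar emax) + r1 / 2.
pose lo : R := mu_of (thstar emin) - r2 / 2.
have btw e : (between lo hi : set 'rV[R]_k.+1) (thstar e).
  have h1 := maxP e isT; have h2 := minP e isT.
  by rewrite /between /lo /hi; split => /=; move: h1 h2 => /= h1 h2; lra.
have m_ab := @measurable_above R k hi; have m_be := @measurable_below R k lo.
have above_gt0 : (0 < Prior (above hi))%E.
  apply: (prior_nbhs_gt0 Hlam Hcompact (x := thstar emax + const_mx r1)) => //.
  have : nbhs (thstar emax + const_mx r1) [set x : 'rV[R]_k.+1 | hi < mu_of x].
    apply: open_nbhs_nbhs; split; first exact: open_mu_gt.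
    by rewrite /hi /mu_of /= !mxE; lra.
  by apply: filterS => x /= hx; rewrite /above /= => /(lt_trans hx); rewrite ltxx.
have below_gt0 : (0 < Prior (below lo))%E.
  apply: (prior_nbhs_gt0 Hlam Hcompact (x := thstar emin + const_mx (- r2))) => //.
  have : nbhs (thstar emin + const_mx (- r2)) [set x : 'rV[R]_k.+1 | mu_of x < lo].
    apply: open_nbhs_nbhs; split; first exact: open_mu_lt.
    by rewrite /lo /mu_of /= !mxE; lra.
  by apply: filterS => x /= hx; rewrite /below /= => /(lt_trans hx); rewrite ltxx.
pose pst t w e (B : set (Borel_rV R k.+1)) := post lam Theta p (D ^~ w) (Ys ^~ w) t e B.
have pst0 t w e (B : set (Borel_rV R k.+1)) : measurable B -> 0 <= pst t w e B.
  by move=> mB; exact: (post_ge0 Hlam Hcompact (Tstar d) p0).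
have pst_meas t e (B : set (Borel_rV R k.+1)) : measurable B ->
    measurable_fun setT (fun w : g_sigma_algebraType (G t) => pst t w e B).
  move=> mB; apply: (measurable_post Hlam Hcompact (Tstar d) p0 mp Hcont) => // s st.
  - exact: mD.
  - exact: mY.
have Hdraw' t (A : set Om) : <<s G t >> A -> forall (J : nat) (B : nat -> Des -> set (Borel_rV R k.+1)),
    (forall j e, measurable (B j e)) ->
    P (A `&` [set w | forall j, (j <= J)%N -> forall e, B j e (Th t j w e)])
    = (\int[P]_(w in A) (\prod_(j < J.+1) \prod_(e : Des) pst t w e (B j e))%:E)%E.
  move=> GA J B mB; apply: Hdraw => //.
  move: A GA; apply: smallest_sub; first exact: smallest_sigma_algebra.
  by move=> A GA; apply: sub_sigma_algebra; left.
have mG t A : <<s G t >> A -> measurable A by apply: sub_meas; exact: obs_meas.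
have hit := hit_probability Hm mF0 HDmeas HCmeas Hgam Hgam_meas pst0 pst_meas Hdraw' Hsel d lo hi.
have recur := ae_recurrent mG GS (fun t => mD d t.+1 t (ltnSn t))
  (measurable_exploration pst_meas d lo hi) (rate_gt0 R ctx d) hit.
have bd e := posterior_bounded_below Hlam Hcompact (Tstar d) p0 mp Hcont Hnu p1 (Hinterior e)
  (ident e) (llr e) (HKLfin e) (KLcont e) mF GF GS (mD e) (mDF e) mY HYmeas (obs e)
  (openI (@open_mu_gt R k lo) (@open_mu_lt R k hi)) (btw e).
have ab := ae_post_gt0 (Tstar d) p0 mp Hcont Hnu (Hinterior d) (HKLfin d) mF (mDF d) HYmeas (obs d) m_ab above_gt0.
have be := ae_post_gt0 (Tstar d) p0 mp Hcont Hnu (Hinterior d) (HKLfin d) mF (mDF d) HYmeas (obs d) m_be below_gt0.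
have {}bd : {ae P, forall w, forall e, exists2 kap : R, 0 < kap & forall t,
    kap <= post lam Theta p (D ^~ w) (Ys ^~ w) t e (between lo hi)}.
  by apply: filter_forall; exact: bd.
apply: filterS (filterI recur (filterI bd (filterI ab be))) => w [rec [bdw [abw bew]]].
apply: (@count_diverges R (fun t => D t w == d)) => t0; apply: contrapT => none.
have avoid s : (t0 <= s)%N -> D s w <> d.
  by move=> ts E; apply: none; exists s => //; rewrite E eqxx.
have ex_k e : exists kap : R, 0 < kap /\ forall t, kap <= post lam Theta p (D ^~ w) (Ys ^~ w) t e (between lo hi).
  by have [kap k0 hk] := bdw e; exists kap.
have [kap hkap] := choice ex_k.
(* If [d] is not chosen from [t0] on, its posterior stays as it was at [t0], charging both [above]
   and [below]; every other design keeps at least [kap e] on [between]. *)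
pose low top e := if e == d then pst t0 w d (target d lo hi top d) else kap e.
have low0 top e : 0 < low top e.
  rewrite /low; case: eqP => [_|_]; last by have [] := hkap e.
  by rewrite /target eqxx; case: top; [exact: abw|exact: bew].
have lowle top t e : (t0 <= t)%N -> low top e <= pst t w e (target d lo hi top e).
  move=> tt; rewrite /low; case: (eqVneq e d) => [->|ne].
    by rewrite /pst (@post_stable R k Des Y lam Theta p (D ^~ w) (Ys ^~ w) t0 t d _ tt avoid).
  by rewrite /target (negbTE ne); exact: (hkap e).2.
pose kappa := \prod_(e : Des) low false e * \prod_(e : Des) low true e.
have kappa0 : 0 < kappa by rewrite mulr_gt0// prodr_gt0.
(* The index makes the threshold in [ae_recurrent] at most [kappa], which bounds [exploration] from
   below at all times from [t0] on. *)
apply: (rec t0 (Num.bound kappa^-1)) => t tt; split; first exact: avoid.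
apply: (@le_trans _ _ kappa).
  rewrite -[leRHS]invrK lef_pV2 ?posrE ?invr_gt0 ?ltr0Sn//.
  apply: ltW; apply: lt_trans (archi_boundP _) _; first by rewrite invr_ge0 ltW.
  by rewrite ltr_nat.
rewrite /kappa /exploration; apply: ler_pM.
- by apply: prodr_ge0 => e _; exact: ltW.
- by apply: prodr_ge0 => e _; exact: ltW.
- by apply: ler_prod => e _; rewrite ltW// lowle.
- by apply: ler_prod => e _; rewrite ltW// lowle.
Qed.
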